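(* Let $X$ be a complex Banach space and let $T$ be a bounded linear operator on $X$. Then the following statements are equivalent: (1) $\sigma_{pBF}(T)$ is empty; (2) $\sigma_{pBW}(T)$ is empty; (3) $\sigma_{GK}(T)$ is empty; (4) $\sigma(T)$ is finite.
   Context: For a bounded operator $T$ on $X$, write $N(T)$ and $R(T)$ for its kernel and range, and $R^{\infty}(T)=\bigcap_{n\ge 0}R(T^n)$. $T$ is Fredholm if $\dim N(T)<\infty$ and $\operatorname{codim} R(T)<\infty$; it is Weyl if it is Fredholm of index $\dim N(T)-\operatorname{codim}R(T)=0$. $T$ is a Kato (or semi-regular) operator if $R(T)$ is closed and $N(T)\subseteq R^{\infty}(T)$. $T$ is quasi-nilpotent if $\sigma(T)\subseteq\{0\}$. A decomposition $X=X_1\oplus X_2$, $T=T_1\oplus T_2$ means that $X_1,X_2$ are closed $T$-invariant subspaces of $X$ (possibly $\{0\}$) with $X$ their direct sum, and $T_i=T|_{X_i}$. $T$ is pseudo B-Fredholm (respectively pseudo B-Weyl, pseudo Fredholm) if there is such a decomposition with $T_2$ quasi-nilpotent and $T_1$ Fredholm (respectively Weyl, Kato). The corresponding spectra are $\sigma_{pBF}(T)=\{\lambda\in\mathbb{C}: T-\lambda \text{ is not pseudo B-Fredholm}\}$, $\sigma_{pBW}(T)=\{\lambda\in\mathbb{C}: T-\lambda\text{ is not pseudo B-Weyl}\}$, $\sigma_{GK}(T)=\{\lambda\in\mathbb{C}: T-\lambda\text{ is not pseudo Fredholm}\}$. *)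

(* Defs.v *)
From HB Require Import structures.
From mathcomp Require Import all_boot all_order all_algebra.
From mathcomp Require Import complex.
From mathcomp Require Import all_classical all_reals all_analysis.

Set Implicit Arguments.
Unset Strict Implicit.
Unset Printing Implicit Defensive.

Import Order.TTheory GRing.Theory Num.Theory.
Import numFieldNormedType.Exports.

Local Open Scope classical_set_scope.
Local Open Scope ring_scope.

Record closedSubspace (K : numFieldType) (X : normedModType K) :=
  ClosedSubspace {
    csub_pred :> {pred X};
    csub_submod : GRing.submod_closed csub_pred;
    csub_closed : closed [set x | x \in csub_pred] }.
Arguments csub_submod {K X} _.
Arguments csub_closed {K X} _.

(* The subspace [M] as a Banach space with the restricted norm; a fresh type,
   separate from [set_type], which already carries the initial topology. *)
Record csubType (K : numFieldType) (X : normedModType K)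
  (M : closedSubspace X) := CsubType {
    csub_val : X;
    csub_valP : csub_val \in csub_pred M }.

Section ClosedSubspaceBanach.
Context {K : numFieldType} {X : completeNormedModType K}.
Variable M : closedSubspace X.

HB.instance Definition _ :=
  GRing.isSubmodClosed.Build K X (csub_pred M) (csub_submod M).

HB.instance Definition _ := [isSub for @csub_val K X M].
HB.instance Definition _ := [Choice of csubType M by <:].
HB.instance Definition _ := [SubChoice_isSubLmodule of csubType M by <:].

Let norm (x : csubType M) : K := `|val x|.

Let norm_triangle x y : norm (x + y) <= norm x + norm y.
Proof. by rewrite /norm raddfD /= ler_normD. Qed.

Let normZ (l : K) x : norm (l *: x) = `|l| * norm x.
Proof. by rewrite /norm linearZ /= normrZ. Qed.

Let norm0_eq0 x : norm x = 0 -> x = 0.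
Proof. by move=> /normr0_eq0 x0; apply: val_inj; rewrite x0 raddf0. Qed.

HB.instance Definition _ :=
  Lmodule_isNormed.Build K (csubType M) norm_triangle normZ norm0_eq0.

Let complete (F : set_system (csubType M)) :
  ProperFilter F -> cauchy F -> cvg F.
Proof.
move=> FF /cauchy_ballP Fc.
have Gc : cauchy (val @ F : set_system X).
  apply/cauchy_ballP => e e0; have [[P Q] /= [FP FQ] PQe] := Fc e e0.
  exists (val @` P, val @` Q) => /=.
    by split; [move: FP|move: FQ]; apply: filterS => x Ax; exists x.
  move=> [_ _] /= [[x Px <-] [y Qy <-]].
  have := PQe (x, y) (conj Px Qy).
  by rewrite -!ball_normE /ball_ /= {1}/Num.norm /= /norm raddfB.
have Gcvg : cvg (val @ F : set_system X) by exact: cauchy_cvg.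
have [l Gl] := (cvg_ex _).1 Gcvg.
have Ml : l \in csub_pred M.
  apply: (@closed_cvg _ _ F FF val _ (csub_closed M) _ l Gl).
  by apply: nearW => x; exact: valP.
apply/cvg_ex; exists (CsubType Ml); apply/cvgrPdist_lt => e e0.
by move/cvgrPdist_lt: Gl => /(_ e e0).
Qed.

HB.instance Definition _ := Uniform_isComplete.Build (csubType M) complete.

End ClosedSubspaceBanach.

Section Operators.
Context {K : numFieldType}.
Implicit Types X : completeNormedModType K.

(* by linear_boundedP this is |T x| <= r |x| for some r and all x *)
Definition bounded_operator X (T : {linear X -> X}) : Prop :=
  bounded_near T (nbhs (0 : X)).

Definition op_sub X (T : {linear X -> X}) (lambda : K) : {linear X -> X} :=
  T \- lambda \*: idfun.

Definition op_invertible X (T : {linear X -> X}) : Prop :=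
  exists S : {linear X -> X},
    [/\ bounded_operator S, cancel T S & cancel S T].

Definition spectrum X (T : {linear X -> X}) : set K :=
  [set lambda | ~ op_invertible (op_sub T lambda)].

Definition quasi_nilpotent X (T : {linear X -> X}) : Prop :=
  spectrum T `<=` [set 0].

Definition op_kernel X (T : {linear X -> X}) : set X := T @^-1` [set 0].

Definition op_range_infty X (T : {linear X -> X}) : set X :=
  \bigcap_n range (iter n T).

(* [e] is a basis of the linear subspace [N] *)
Definition has_dim X (N : set X) (n : nat) : Prop :=
  exists e : 'I_n -> X, (forall i, N (e i)) /\
    forall x, N x -> exists! c : 'rV[K]_n, x = \sum_(i < n) c 0 i *: e i.

(* the classes of the [e i] form a basis of the quotient of [X] by [N] *)
Definition has_codim X (N : set X) (n : nat) : Prop :=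
  exists e : 'I_n -> X,
    forall x, exists! c : 'rV[K]_n, N (x - \sum_(i < n) c 0 i *: e i).

Definition fredholm X (T : {linear X -> X}) : Prop :=
  (exists n, has_dim (op_kernel T) n) /\ (exists m, has_codim (range T) m).

Definition has_index X (T : {linear X -> X}) (k : int) : Prop :=
  exists n m, [/\ has_dim (op_kernel T) n, has_codim (range T) m &
    k = n%:Z - m%:Z].

Definition weyl X (T : {linear X -> X}) : Prop := fredholm T /\ has_index T 0.

Definition kato X (T : {linear X -> X}) : Prop :=
  closed (range T) /\ op_kernel T `<=` op_range_infty T.

Definition invariant_subspace X (T : {linear X -> X}) (M : closedSubspace X) : Prop :=
  forall x, x \in csub_pred M -> T x \in csub_pred M.

Section Restriction.
Variables (X : completeNormedModType K) (T : {linear X -> X}).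
Variables (M : closedSubspace X) (TM : invariant_subspace T M).

Definition restrict_fun (x : csubType M) : csubType M :=
  CsubType (TM (csub_valP x)).

Lemma restrict_fun_linear : linear restrict_fun.
Proof. by move=> a x y; apply: val_inj; rewrite /= !linearP. Qed.

HB.instance Definition _ := GRing.isLinear.Build K (csubType M) (csubType M)
  *:%R restrict_fun restrict_fun_linear.

Definition op_restrict : {linear csubType M -> csubType M} := restrict_fun.

End Restriction.

Definition direct_sum X (X1 X2 : closedSubspace X) : Prop :=
  (forall x, exists x1 x2, [/\ x1 \in csub_pred X1, x2 \in csub_pred X2 &
     x = x1 + x2]) /\
  (forall x, x \in csub_pred X1 -> x \in csub_pred X2 -> x = 0).

(* [T = T1 (+) T2] with [T1] in the class [P] and [T2] quasi-nilpotent *)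
Definition pseudo (P : forall Y : completeNormedModType K,
    {linear Y -> Y} -> Prop) X (T : {linear X -> X}) : Prop :=
  exists (X1 X2 : closedSubspace X) (T1 : invariant_subspace T X1) (T2 : invariant_subspace T X2),
    [/\ direct_sum X1 X2, P _ (op_restrict T1) &
      quasi_nilpotent (op_restrict T2)].

Definition pseudo_B_fredholm := pseudo fredholm.
Definition pseudo_B_weyl := pseudo weyl.
Definition pseudo_fredholm := pseudo kato.

Definition sigma_pBF X (T : {linear X -> X}) : set K :=
  [set lambda | ~ pseudo_B_fredholm (op_sub T lambda)].

Definition sigma_pBW X (T : {linear X -> X}) : set K :=
  [set lambda | ~ pseudo_B_weyl (op_sub T lambda)].

Definition sigma_GK X (T : {linear X -> X}) : set K :=
  [set lambda | ~ pseudo_fredholm (op_sub T lambda)].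

End Operators.

(* Main.v *)
Require Import Defs.
From HB Require Import structures.
From mathcomp Require Import all_boot all_order all_algebra.
From mathcomp Require Import complex.
From mathcomp Require Import all_classical all_reals all_analysis.
From mathcomp Require Import ring lra.

Set Implicit Arguments.
Unset Strict Implicit.
Unset Printing Implicit Defensive.

Import Order.TTheory GRing.Theory Num.Theory.
Import numFieldNormedType.Exports.

Local Open Scope classical_set_scope.
Local Open Scope ring_scope.

(* If [S] is Kato and [S - mu] is invertible for a single small [mu], then [S] is
   invertible.  For Fredholm [S], restricting to the range of a large power of [S]
   gives a Kato operator which determines the invertibility of [S - mu], mu <> 0.
   Hence, around every point where [T] admits a decomposition, a punctured disk lies
   either in the spectrum or in the resolvent set; as the plane is connected and
   the spectrum bounded, the second case holds everywhere and the spectrum is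
   finite by compactness.

   Conversely, if the punctured disk 0 < |z| <= 1 misses the spectrum of [A], the
   Riesz projection is obtained without contour integrals as the limit of
   (1 - A^(2^k))^-1: this is the mean of (1 - w A)^-1 over the 2^k-th roots of unity
   [w], and it converges geometrically since the resolvent is Lipschitz on the
   unit circle. *)

(** * The real-valued norm *)

(** A Fredholm or Kato operator may have a whole disk of spectrum around it, so locally nothing
    better than a dichotomy can hold; the bad alternative is only excluded globally, starting from
    points of large modulus. In the other direction, the first summand of the Riesz decomposition is
    invertible, hence Fredholm, Weyl and Kato at once, which is why the three spectra can only be
    empty together. The mean over the roots of unity is the trapezoidal rule for the Riesz integral
    over the unit circle. It approximates the identity on the part of the space with spectrum inside
    the circle, where [A^(2^k)] tends to 0, and it tends to 0 on the part with spectrum outside. The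
    limit is therefore the projection onto the quasi-nilpotent part. Doubling the number of roots
    averages over pairs of opposite points; this contracts the Lipschitz constant and so gives the
    rate of convergence. *)

Section Norm.
Context {R : realType}.

(* The norm as a real number, since [R[i]] is only partially ordered. *)
Definition nm (V : normedZmodType R[i]) (x : V) : R := complex.Re `|x|.

Lemma nmE (V : normedZmodType R[i]) (x : V) : (nm x)%:C%C = `|x|.
Proof. by apply: RRe_real; exact: normr_real. Qed.

Lemma nm_ge0 (V : normedZmodType R[i]) (x : V) : 0 <= nm x.
Proof. by rewrite -lecR nmE normr_ge0. Qed.

Lemma nmD (V : normedZmodType R[i]) (x y : V) : nm (x + y) <= nm x + nm y.
Proof. by rewrite -lecR rmorphD /= !nmE ler_normD. Qed.

Lemma nmN (V : normedZmodType R[i]) (x : V) : nm (- x) = nm x.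
Proof. by rewrite /nm normrN. Qed.

Lemma nmB (V : normedZmodType R[i]) (x y : V) : nm (x - y) <= nm x + nm y.
Proof. by rewrite -(nmN y) nmD. Qed.

Lemma nm_distC (V : normedZmodType R[i]) (x y : V) : nm (x - y) = nm (y - x).
Proof. by rewrite -nmN opprB. Qed.

Lemma nm0 (V : normedZmodType R[i]) : nm (0 : V) = 0.
Proof. by rewrite /nm normr0. Qed.

Lemma nm_eq0 (V : normedZmodType R[i]) (x : V) : nm x = 0 -> x = 0.
Proof. by move=> x0; apply/eqP; rewrite -normr_eq0 -nmE x0. Qed.

Lemma nm_le0 (V : normedZmodType R[i]) (x : V) : nm x <= 0 -> x = 0.
Proof. by move=> x0; apply: nm_eq0; apply/eqP; rewrite eq_le x0 nm_ge0. Qed.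

Lemma nm_gt0 (V : normedZmodType R[i]) (x : V) : (0 < nm x) = (x != 0).
Proof. by rewrite -ltcR nmE normr_gt0. Qed.

Lemma nmZ (V : normedModType R[i]) (a : R[i]) (x : V) :
  nm (a *: x) = nm a * nm x.
Proof. by apply: complexI; rewrite rmorphM /= !nmE normrZ. Qed.

Lemma nmM (a b : R[i]) : nm (a * b) = nm a * nm b.
Proof. by apply: complexI; rewrite rmorphM /= !nmE normrM. Qed.

Lemma nmR (a : R) : nm a%:C%C = `|a|.
Proof. by apply: complexI; rewrite nmE normc_def /= expr0n /= addr0 sqrtr_sqr. Qed.

Lemma nm1 : nm (1 : R[i]) = 1.
Proof. by rewrite (_ : 1 = 1%:C%C)// nmR normr1. Qed.

Lemma nmV (a : R[i]) : nm a^-1 = (nm a)^-1.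
Proof. by apply: complexI; rewrite fmorphV /= !nmE normfV. Qed.

Lemma nmX (a : R[i]) n : nm (a ^+ n) = nm a ^+ n.
Proof. by elim: n => [|n IH]; rewrite ?expr0 ?nm1// !exprS nmM IH. Qed.

Lemma nm_sqr (z : R[i]) :
  nm z ^+ 2 = complex.Re z ^+ 2 + complex.Im z ^+ 2.
Proof. by apply: complexI; rewrite add_Re2_Im2 rmorphXn /= nmE. Qed.

Lemma nm_parallelogram (a b : R[i]) :
  nm (a + b) ^+ 2 + nm (a - b) ^+ 2 = 2 * (nm a ^+ 2 + nm b ^+ 2).
Proof.
by rewrite !nm_sqr; case: a => a1 a2; case: b => b1 b2 /=; ring.
Qed.

End Norm.

(** * Boundedness, closedness and geometric convergence in the real norm *)

Section Basics.
Context {R : realType}.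

Lemma small_geometric (q c e : R) : 0 <= q < 1 -> 0 < e ->
  exists n, forall m, (n <= m)%N -> c * q ^+ m < e.
Proof.
move=> /andP[q0 q1] e0.
have q1' : `|q| < 1 by rewrite ger0_norm.
have /cvgrPdist_lt /(_ e e0) [n _ H] := cvg_geometric c q1'.
exists n => m nm; have := H m nm; rewrite /= sub0r normrN => h.
by apply: le_lt_trans h; exact: ler_norm.
Qed.

(** Identities between limits are proved through this bound, applied to the norm of the difference
    of the two sides. *)
Lemma le_geometric0 (a q c : R) : 0 <= q < 1 ->
  (forall n, a <= c * q ^+ n) -> a <= 0.
Proof.
move=> q01 H; rewrite leNgt; apply/negP => a0.
have [n /(_ n (leqnn _))] := small_geometric c q01 a0.
by rewrite ltNge H.
Qed.

Lemma half01 : 0 <= (2^-1 : R) < 1.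
Proof. by apply/andP; split; lra. Qed.

Lemma divr_half (c : R) : c / (1 - 2^-1) = 2 * c.
Proof. by field. Qed.

Lemma bounded_nearP (X Y : normedModType R[i]) (T : {linear X -> Y}) :
  bounded_near T (nbhs (0 : X)) <->
  exists2 c : R, 0 < c & forall x, nm (T x) <= c * nm x.
Proof.
rewrite linear_boundedP; split.
  (* The bound is only known for values strictly above [M], hence the [+ 1]. *)
  move=> [M [Mr H]]; exists (nm M + 1); first by rewrite ltr_wpDl ?nm_ge0.
  move=> x; rewrite -lecR rmorphM /= !nmE; apply: H.
  by rewrite rmorphD /= nmE ltr_pwDr// real_ler_norm.
move=> [c c0 H]; exists c%:C%C; split; first by rewrite realE lecR ltW.
move=> r /ltW cr x; apply: (@le_trans _ _ (c%:C%C * `|x|)).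
  by rewrite -!nmE -rmorphM lecR.
by rewrite ler_wpM2r.
Qed.

Lemma closed_nmP (X : normedModType R[i]) (A : set X) :
  closed A <->
  (forall x, (forall e : R, 0 < e -> exists2 a, A a & nm (x - a) < e) -> A x).
Proof.
split => cA x.
  move=> H; apply: cA => B /nbhs_ballP[e /= e0 xB].
  have er : (nm e)%:C%C = e by rewrite nmE gtr0_norm.
  have [|a Aa xa] := H (nm e); first by rewrite nm_gt0 gt_eqF.
  by exists a; split => //; apply: xB; rewrite -ball_normE /ball_ /= -nmE -er ltcR.
move=> clx; apply: cA => e e0.
have [|a [Aa xa]] := clx (ball x e%:C%C).
  by apply: nbhsx_ballx; rewrite ltcR.
exists a => //; move: xa; rewrite -ball_normE /ball_ /= -nmE.
by rewrite ltcR.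
Qed.

Lemma geometric_dist (Y : zmodType) (N : Y -> R) (q c : R) (u : nat -> Y) :
  N 0 = 0 -> (forall x, N (- x) = N x) ->
  (forall x y, N (x + y) <= N x + N y) ->
  0 <= q < 1 -> (forall n, N (u n.+1 - u n) <= c * q ^+ n) ->
  forall n k, N (u n - u (n + k)%N) <= c / (1 - q) * q ^+ n.
Proof.
move=> N0 NN ND /andP[q0 q1] H n k.
have Npos x : 0 <= N x.
  by have := ND x (- x); rewrite subrr N0 NN; lra.
have c0 : 0 <= c by have := H 0%N; rewrite expr0 mulr1; apply: le_trans.
have q1' : 0 < 1 - q by rewrite subr_gt0.
(* The exact partial sum of the geometric series, a form that the induction on [k] preserves. *)
suff : N (u n - u (n + k)%N) <= c / (1 - q) * (q ^+ n - q ^+ (n + k)).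
  move/le_trans; apply; apply: ler_wpM2l; first by rewrite divr_ge0 ?(ltW q1').
  by rewrite gerBl exprn_ge0.
elim: k => [|k IH]; first by rewrite addn0 !subrr mulr0 N0.
rewrite addnS -(subrKA (u (n + k)%N)).
apply: (le_trans (ND _ _)); apply: (le_trans (lerD IH _)).
  rewrite -opprB NN; exact: H.
rewrite le_eqVlt; apply/orP; left; apply/eqP.
by rewrite exprS; field; rewrite gt_eqF.
Qed.

(* Completeness of [Y] for a norm [N], usable when [Y] carries no
   [completeNormedModType] instance. *)
Definition geometrically_complete (Y : zmodType) (N : Y -> R) :=
  forall (u : nat -> Y) (c q : R), 0 <= q < 1 ->
    (forall n, N (u n.+1 - u n) <= c * q ^+ n) ->
    exists l, forall n, N (u n - l) <= c / (1 - q) * q ^+ n.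

(** Mere convergence is enough: the rate follows from [geometric_dist] when the second index tends
    to infinity. *)
Lemma geometrically_completeP (Y : zmodType) (N : Y -> R) :
  N 0 = 0 -> (forall x, N (- x) = N x) ->
  (forall x y, N (x + y) <= N x + N y) ->
  (forall (u : nat -> Y) (C q : R), 0 <= q < 1 ->
    (forall n k, N (u n - u (n + k)%N) <= C * q ^+ n) ->
    exists l, forall e : R, 0 < e -> exists m, forall n, (m <= n)%N ->
      N (u n - l) < e) ->
  geometrically_complete N.
Proof.
move=> N0 NN ND H u c q q01 uc.
have D := geometric_dist N0 NN ND q01 uc.
have [l Hl] := H _ _ _ q01 D.
exists l => n; apply/ler_addgt0Pr => e e0.
have [m /(_ (n + m)%N (leq_addl _ _)) h] := Hl e e0.
rewrite -(subrKA (u (n + m)%N)).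
by apply: (le_trans (ND _ _)); apply: lerD; [exact: D | exact: ltW].
Qed.

Lemma complete_geometric (X : completeNormedModType R[i]) :
  geometrically_complete (@nm R X).
Proof.
apply: geometrically_completeP; [exact: nm0|exact: nmN|exact: nmD|].
move=> u C q q01 D.
have uc : cauchy (u @ \oo).
  apply: cauchy_exP => e e0.
  have er : (nm e)%:C%C = e by rewrite nmE gtr0_norm.
  have e0' : 0 < nm e by rewrite nm_gt0 gt_eqF.
  have [n Hn] := small_geometric C q01 e0'.
  exists (u n); exists n => //= m /= nm_.
  rewrite -ball_normE /ball_ /= -nmE -er ltcR.
  by apply: le_lt_trans (Hn n (leqnn _)); rewrite -(subnKC nm_); exact: D.
have ucvg : cvg (u @ \oo) by exact: cauchy_cvg.
have [l ul] := (cvg_ex _).1 ucvg.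
exists l => e e0.
move/cvgrPdist_lt: ul => /(_ e%:C%C); rewrite ltcR => /(_ e0) [m _ Hm].
by exists m => n /Hm /=; rewrite -nmE ltcR nm_distC.
Qed.

Lemma real_geometric_cvg (u : nat -> R) (C q : R) : 0 <= q < 1 ->
  (forall n k, `|u n - u (n + k)%N| <= C * q ^+ n) ->
  exists l, forall e : R, 0 < e -> exists m, forall n, (m <= n)%N ->
    `|u n - l| < e.
Proof.
move=> q01 D.
have uc : cauchy (u @ \oo : set_system R^o).
  apply: cauchy_exP => e e0.
  have [n Hn] := small_geometric C q01 e0.
  exists (u n); exists n => //= m /= nm_.
  rewrite -ball_normE /ball_ /=.
  by apply: le_lt_trans (Hn n (leqnn _)); rewrite -(subnKC nm_); exact: D.
have ucvg : cvg (u @ \oo : set_system R^o) by exact: cauchy_cvg.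
have [l ul] := (cvg_ex _).1 ucvg.
exists l => e e0; move/cvgrPdist_lt: ul => /(_ e e0) [m _ Hm].
by exists m => n /Hm /=; rewrite distrC.
Qed.

Lemma norm_Re_le (z : R[i]) : `|complex.Re z| <= nm z.
Proof. by rewrite -lecR nmE; exact: normc_ge_Re. Qed.

Lemma norm_Im_le (z : R[i]) : `|complex.Im z| <= nm z.
Proof.
rewrite -(@ler_pXn2r _ 2) ?nnegrE ?nm_ge0// real_normK ?num_real//.
by rewrite nm_sqr lerDr sqr_ge0.
Qed.

Lemma nm_le_ReIm (z : R[i]) : nm z <= `|complex.Re z| + `|complex.Im z|.
Proof.
rewrite -(@ler_pXn2r _ 2) ?nnegrE ?nm_ge0 ?addr_ge0// nm_sqr sqrrD.
by rewrite !real_normK ?num_real// addrAC lerDl mulrn_wge0// mulr_ge0.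
Qed.

Lemma complex_geometric : geometrically_complete (@nm R R[i]).
Proof.
apply: geometrically_completeP; [exact: nm0|exact: nmN|exact: nmD|].
move=> u C q q01 D.
have [|a Ha] := @real_geometric_cvg (fun n => complex.Re (u n)) C q q01.
  move=> n k; apply: le_trans (D n k); rewrite -raddfB; exact: norm_Re_le.
have [|b Hb] := @real_geometric_cvg (fun n => complex.Im (u n)) C q q01.
  move=> n k; apply: le_trans (D n k); rewrite -raddfB; exact: norm_Im_le.
exists (a +i* b)%C => e e0; have e2 : 0 < e / 2 by lra.
have [m1 H1] := Ha _ e2; have [m2 H2] := Hb _ e2.
exists (maxn m1 m2) => n; rewrite geq_max => /andP[/H1 h1 /H2 h2].
apply: le_lt_trans (nm_le_ReIm _) _; rewrite !raddfB /=; lra.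
Qed.

(** Serves to adjoin a scalar coordinate to the domain of an operator in [finite_codim_closed]. *)
Lemma prod_geometric (Y Z : zmodType) (N : Y -> R) (M : Z -> R) :
  N 0 = 0 -> (forall x, N (- x) = N x) ->
  (forall x y, N (x + y) <= N x + N y) ->
  M 0 = 0 -> (forall x, M (- x) = M x) ->
  (forall x y, M (x + y) <= M x + M y) ->
  geometrically_complete N -> geometrically_complete M ->
  geometrically_complete (fun p : Y * Z => N p.1 + M p.2).
Proof.
move=> N0 NN ND M0 MN MD Nc Mc.
have Npos x : 0 <= N x by have := ND x (- x); rewrite subrr N0 NN; lra.
have Mpos x : 0 <= M x by have := MD x (- x); rewrite subrr M0 MN; lra.
apply: geometrically_completeP => [|x|x y|].
- by rewrite /= N0 M0 addr0.
- by rewrite /= NN MN.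
- by have := ND x.1 y.1; have := MD x.2 y.2 => /=; lra.
move=> u C q q01 D.
have [|a Ha] := Nc (fun n => (u n).1) C q q01.
  move=> n; have := D n 1%N; rewrite addn1 /= -NN opprB.
  by have := Mpos ((u n).2 - (u n.+1).2); lra.
have [|b Hb] := Mc (fun n => (u n).2) C q q01.
  move=> n; have := D n 1%N; rewrite addn1 /= -MN opprB.
  by have := Npos ((u n).1 - (u n.+1).1); lra.
exists (a, b) => e e0.
have [m Hm] := small_geometric (2 * (C / (1 - q))) q01 e0.
exists m => n /Hm h; apply: le_lt_trans h => /=.
by have := Ha n; have := Hb n; lra.
Qed.

End Basics.

(** * Open mapping *)

Section OpenMapping.
Context {R : realType}.

(** Baire's theorem relative to [V]: if no [F n] were dense in a ball of [V], one could choose balls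
    centred in [V] that avoid the [F n] one after another. Each centre moves by at most a quarter of
    the radius and each radius is at most half the previous one, so the limit stays within half the
    radius of every centre and lies in no [F n]. *)
Lemma baire_closed (X : completeNormedModType R[i]) (V : set X)
    (F : nat -> set X) :
  closed V -> V !=set0 -> (forall x, V x -> exists n, F n x) ->
  exists n x r, [/\ V x, 0 < r & forall y, V y -> nm (y - x) < r ->
    forall e : R, 0 < e -> exists2 z, F n z & nm (y - z) < e].
Proof.
move=> /closed_nmP clV [x0 Vx0] cover; apply: contrapT => none.
have step (np : nat * (X * R)) : exists p' : X * R,
    V np.2.1 /\ 0 < np.2.2 -> [/\ V p'.1 /\ 0 < p'.2,
      nm (p'.1 - np.2.1) <= np.2.2 / 4, p'.2 <= np.2.2 / 2 &
      forall z, F np.1 z -> p'.2 <= nm (p'.1 - z)].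
  case: np => n [x r] /=.
  have [[Vx r0]|] := pselect (V x /\ 0 < r); last by exists (x, r).
  have /existsNP[y] : ~ (forall y, V y -> nm (y - x) < r / 4 ->
      forall e : R, 0 < e -> exists2 z, F n z & nm (y - z) < e).
    by move=> H; apply: none; exists n, x, (r / 4); split => //; lra.
  move=> /not_implyP[Vy] /not_implyP[yx] /existsNP[e] /not_implyP[e0 He].
  exists (y, Num.min e (r / 2)) => _; split => /=.
  - by split => //; rewrite lt_min e0 divr_gt0.
  - exact: ltW.
  - by rewrite ge_min lexx orbT.
  - move=> z Fz; rewrite leNgt; apply/negP; rewrite lt_min => /andP[h _].
    by apply: He; exists z.
have [f Hf] := choice step.
pose p := fix p n := if n is k.+1 then f (k, p k) else (x0, 1 : R).
have pV n : V (p n).1 /\ 0 < (p n).2.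
  by elim: n => [|n IH] /=; [split | case: (Hf (n, p n) IH)].
have pS n : [/\ nm ((p n.+1).1 - (p n).1) <= (p n).2 / 4,
    (p n.+1).2 <= (p n).2 / 2 &
    forall z, F n z -> (p n.+1).2 <= nm ((p n.+1).1 - z)].
  by case: (Hf (n, p n) (pV n)).
have pr n k : (p (n + k)%N).2 <= (p n).2 * 2^-1 ^+ k.
  elim: k => [|k IH]; first by rewrite addn0 expr0 mulr1.
  rewrite addnS exprSr; have [_ h _] := pS (n + k)%N.
  by apply: (le_trans h); rewrite mulrA; apply: ler_wpM2r.
have D n k : nm ((p n).1 - (p (n + k)%N).1) <= (p n).2 / 2.
  have H j : nm ((p (n + j.+1)%N).1 - (p (n + j)%N).1) <=
      (p n).2 / 4 * 2^-1 ^+ j.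
    rewrite addnS; have [h _ _] := pS (n + j)%N; apply: (le_trans h).
    by have := pr n j; lra.
  have := geometric_dist (u := fun j => (p (n + j)%N).1)
    (nm0 X) (@nmN _ X) (@nmD _ X) half01 H 0 k.
  by rewrite addn0 add0n divr_half expr0 mulr1; lra.
have [l Hl] : exists l, forall n,
    nm ((p n).1 - l) <= (1 / 2) * 2^-1 ^+ n.
  have -> : 1 / 2 = (1 / 4) / (1 - 2^-1) :> R by rewrite divr_half; lra.
  apply: (@complete_geometric _ X (fun n => (p n).1)); first exact: half01.
  move=> n; have [h _ _] := pS n; apply: (le_trans h).
  by have := pr 0%N n; rewrite add0n /=; lra.
have lD n : nm ((p n).1 - l) <= (p n).2 / 2.
  apply/ler_addgt0Pr => e e0.
  have [m Hm] := small_geometric ((1 / 2)) half01 e0.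
  rewrite -(subrKA (p (n + m)%N).1); apply: (le_trans (nmD _ _)).
  apply: lerD; first exact: D.
  by apply: (le_trans (Hl _)); apply/ltW/Hm/leq_addl.
have Vl : V l.
  apply: clV => e e0.
  have [m Hm] := small_geometric ((1 / 2)) half01 e0.
  exists (p m).1; first by case: (pV m).
  by rewrite nm_distC; apply: (le_lt_trans (Hl _)); exact: Hm.
have [n Fl] := cover l Vl.
have [_ _ /(_ l Fl) h] := pS n.
have [_ h'] := pV n.+1.
by have := lD n.+1; lra.
Qed.

(** Baire's theorem is applied to the closed range, covered by the images of the balls [N y <= n].
    Differences of two approximations move the resulting ball to the origin, and repeated halving of
    the error leads to an exact preimage. *)
Lemma open_mapping (Y : lmodType R[i]) (N : Y -> R)
    (X : completeNormedModType R[i]) (T : {linear Y -> X}) (b : R) :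
  (forall a y, N (a *: y) = nm a * N y) ->
  (forall x y, N (x + y) <= N x + N y) ->
  geometrically_complete N ->
  (forall y, nm (T y) <= b * N y) -> closed (range T) ->
  exists2 C : R, 0 < C & forall y, exists2 y', T y' = T y & N y' <= C * nm (T y).
Proof.
move=> NZ ND Nc Tb clT.
have N0 : N 0 = 0 by rewrite -(scale0r (0 : Y)) NZ nm0 mul0r.
have NN y : N (- y) = N y by rewrite -scaleN1r NZ nmN nm1 mul1r.
have N_ge0 y : 0 <= N y by have := ND y (- y); rewrite subrr N0 NN; lra.
pose F n := [set T y | y in [set y | N y <= n%:R]].
have [n [x0 [r [[y0 _ y0E] r0 H]]]] : exists n x r, [/\ range T x, 0 < r &
    forall y, range T y -> nm (y - x) < r ->
    forall e : R, 0 < e -> exists2 z, F n z & nm (y - z) < e].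
  apply: baire_closed => //; first by exists (T 0), 0.
  move=> _ [y _ <-]; exists (Num.truncn (N y)).+1, y => //=.
  by rewrite ltW// truncnS_gt.
(* Scaling [T y] to norm [r / 2] and back turns the bound [2 * n] of [approx1] into [4 * n / r]
   times [nm (T y)]; [n + 1] keeps [c] positive. *)
pose c := 4 * (n%:R + 1) / r.
have n0 : 0 <= n%:R :> R by [].
have c0 : 0 < c by rewrite /c divr_gt0//; lra.
have approx1 y e : nm (T y) < r -> 0 < e ->
    exists2 y', N y' <= 2 * n%:R & nm (T y - T y') < e.
  move=> yr e0.
  have e2 : 0 < e / 2 by lra.
  have [||_ [y1 /= Ny1 <-] h1] := H (T (y0 + y)) _ _ (e / 2) e2.
  - by exists (y0 + y).
  - by rewrite raddfD /= y0E addrC addKr.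
  have [||_ [y2 /= Ny2 <-] h2] := H (T y0) _ _ (e / 2) e2.
  - by exists y0.
  - by rewrite y0E subrr nm0.
  exists (y1 - y2); first by have := ND y1 (- y2); rewrite NN; lra.
  have -> : T y - T (y1 - y2) = (T (y0 + y) - T y1) - (T y0 - T y2).
    rewrite (raddfB T y1) (raddfD T y0) /= !opprB [RHS]addrC [RHS]addrA subrKA.
    by rewrite addrCA addrA.
  by apply: (le_lt_trans (nmB _ _)); lra.
have approx y : exists2 y', N y' <= c * nm (T y) &
    nm (T y - T y') <= nm (T y) / 2.
  have [->|Ty0] := eqVneq (T y) 0.
    by exists 0; rewrite ?(raddf0 T) ?subrr nm0 ?N0 ?mulr0 ?mul0r.
  have t0 : 0 < nm (T y) by rewrite nm_gt0.
  pose s := r / (2 * nm (T y)).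
  have s0 : 0 < s by rewrite divr_gt0//; lra.
  have sE : nm (s%:C%C) = s by rewrite nmR gtr0_norm.
  have st : s * nm (T y) = r / 2 by rewrite /s; field; rewrite gt_eqF.
  have [||y' Ny' hy'] := approx1 (s%:C%C *: y) (r / 4); last 1 first.
  - exists ((s%:C%C)^-1 *: y').
      rewrite NZ nmV sE ler_pdivrMl// /c.
      have -> : s * (4 * (n%:R + 1) / r * nm (T y)) = 2 * (n%:R + 1).
        by rewrite /s; field; rewrite !gt_eqF.
      by lra.
    have -> : T y - T ((s%:C%C)^-1 *: y') =
        (s%:C%C)^-1 *: (T (s%:C%C *: y) - T y').
      by rewrite !(linearZZ T) scalerBr scalerA mulVf ?scale1r// -nm_gt0 sE.
    by rewrite nmZ nmV sE ler_pdivrMl// mulrA st; lra.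
  - by rewrite (linearZZ T) nmZ sE st; lra.
  - by lra.
have [g Hg] := choice (fun y => let: ex_intro2 y' h1 h2 := approx y in
  ex_intro (fun y' => N y' <= c * nm (T y) /\ nm (T y - T y') <= nm (T y) / 2)
    y' (conj h1 h2)).
exists (2 * c); first by lra.
(* [v k] is the part of [y] whose image is not yet matched; the approximate preimages [y - v k]
   converge geometrically. *)
move=> y; pose v := fix v k := if k is j.+1 then v j - g (v j) else y.
have vT k : nm (T (v k)) <= nm (T y) * 2^-1 ^+ k.
  elim: k => [|k IH] /=; first by rewrite expr0 mulr1.
  by rewrite raddfB exprSr; have [_ h] := Hg (v k); lra.
have vN k : N (y - v k.+1 - (y - v k)) <= c * nm (T y) * 2^-1 ^+ k.
  rewrite /= !opprB addrC addrA subrK addrC subrK.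
  have [h _] := Hg (v k); apply: (le_trans h); rewrite -mulrA.
  by apply: ler_wpM2l; [exact: ltW | exact: vT].
have [l Hl] := Nc (fun k => y - v k) _ _ half01 vN.
rewrite divr_half in Hl.
exists l.
  apply/eqP; rewrite -subr_eq0; apply/eqP/nm_le0.
  apply: (@le_geometric0 _ _ 2^-1 (nm (T y) + `|b| * (2 * (c * nm (T y))))).
    exact: half01.
  move=> k.
  have -> : T l - T y = - T (v k) - T (y - v k - l).
    by rewrite !(raddfB T) /= !opprB addrCA addKr.
  apply: (le_trans (nmB _ _)); rewrite nmN mulrDl; apply: lerD => //.
  apply: (le_trans (Tb _)); rewrite -mulrA.
  apply: (le_trans (ler_wpM2r _ (ler_norm b))) => //.
  exact: ler_wpM2l.
have := Hl 0%N; rewrite /= subrr sub0r NN expr0 mulr1 => h.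
by apply: (le_trans h); rewrite mulrA.
Qed.

End OpenMapping.

(** * Bijectivity, bounded inverses and perturbation *)

Section Invertibility.
Context {R : realType}.

Lemma linear_bijective (V W : lmodType R[i]) (f : {linear V -> W}) :
  (forall x, f x = 0 -> x = 0) -> (forall y, exists x, f x = y) -> bijective f.
Proof.
move=> f0 fs; have [g Hg] := choice fs.
exists g => // x; apply/eqP; rewrite -subr_eq0; apply/eqP/f0.
by rewrite (raddfB f) /= Hg subrr.
Qed.

Lemma bijective_surj (V W : Type) (f : V -> W) :
  bijective f -> forall y, exists x, f x = y.
Proof. by move=> [g _ fg] y; exists (g y). Qed.

Lemma bijective_ker0 (V W : lmodType R[i]) (f : {linear V -> W}) :
  bijective f -> forall x, f x = 0 -> x = 0.
Proof. by move=> /bij_inj fi x fx; apply: fi; rewrite fx raddf0. Qed.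

Variable X : completeNormedModType R[i].
Implicit Types T S : {linear X -> X}.

Lemma opD T x y : T (x + y) = T x + T y. Proof. exact: raddfD. Qed.
Lemma opB T x y : T (x - y) = T x - T y. Proof. exact: raddfB. Qed.
Lemma opN T x : T (- x) = - T x. Proof. exact: raddfN. Qed.
Lemma op0 T : T 0 = 0. Proof. exact: raddf0. Qed.
Lemma opZ T a x : T (a *: x) = a *: T x. Proof. exact: linearZ. Qed.

(** With [g] the inverse of [T] and [B = S - T], the factor [c / 2] makes [w |-> g (y - B w)] a
    contraction of ratio 1/2, and its fixed point solves [S l = y]. *)
Lemma perturbation_bijective T S (c : R) : 0 < c -> bijective T ->
  (forall x, c * nm x <= nm (T x)) ->
  (forall x, nm (S x - T x) <= c / 2 * nm x) -> bijective S.
Proof.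
move=> c0 bT cT ST; apply: linear_bijective => [x Sx|y].
  have := ST x; rewrite Sx sub0r nmN => h; have := cT x => h'.
  have x0 := nm_ge0 x; apply: nm_le0.
  by have : c * nm x <= 0; [lra | rewrite pmulr_rle0].
case: bT => g gT Tg.
have gle z : nm (g z) <= nm z / c.
  by rewrite ler_pdivlMr// mulrC -{2}(Tg z).
have Tinj : injective T by exact: can_inj gT.
have TgB z w : g z - g w = g (z - w).
  by apply: Tinj; rewrite (raddfB T) /= !Tg.
pose B x := S x - T x.
have BB x z : B x - B z = B (x - z).
  by rewrite /B (raddfB S) (raddfB T) !opprB addrACA [RHS]addrACA (addrC (- T x)).
have gB w : nm (g (B w)) <= nm w / 2.
  apply: (le_trans (gle _)); rewrite ler_pdivrMr//.
  by apply: (le_trans (ST _)); lra.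
have gyB w z : nm (g (y - B w) - g (y - B z)) <= nm (w - z) / 2.
  by rewrite TgB (opprB y) (addrC (y - B w)) subrKA BB nm_distC gB.
pose u := fix u n := if n is k.+1 then g (y - B (u k)) else 0.
have uD n : nm (u n.+1 - u n) <= nm (u 1) * 2^-1 ^+ n.
  elim: n => [|n IH]; first by rewrite expr0 mulr1 /= subr0.
  by rewrite exprSr; have := gyB (u n.+1) (u n); rewrite -/(u n.+1) /=; lra.
have [l] := complete_geometric half01 uD.
rewrite divr_half => Hl.
have lE : l = g (y - B l).
  apply/eqP; rewrite -subr_eq0; apply/eqP/nm_le0.
  apply: (@le_geometric0 _ _ 2^-1 (2 * nm (u 1))); first exact: half01.
  move=> n; rewrite -(subrKA (u n.+1)); apply: (le_trans (nmD _ _)).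
  have h1 := Hl n.+1; have h2 := Hl n; have h3 := gyB (u n) l.
  move: h1; rewrite (nm_distC (u n.+1)) exprSr => h1.
  by apply: (le_trans (lerD h1 h3)); lra.
exists l; have : T l = y - B l by rewrite {1}lE Tg.
by rewrite /B opprB addrCA => /eqP; rewrite eq_sym -subr_eq0 addrAC subrr add0r
  subr_eq0 => /eqP.
Qed.

Lemma bijective_bounded_below T : bounded_operator T -> bijective T ->
  exists2 c : R, 0 < c & forall x, c * nm x <= nm (T x).
Proof.
move=> /bounded_nearP[b b0 Tb] bT.
have Ts := bijective_surj bT.
have [|C C0 HC] := open_mapping (@nmZ _ X) (@nmD _ X) (@complete_geometric _ X)
    Tb.
  rewrite (_ : range T = setT); first exact: closedT.
  by rewrite -subTset => y _; have [x <-] := Ts y; exists x.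
exists C^-1; first by rewrite invr_gt0.
move=> x; have [x' Tx h] := HC x.
by rewrite ler_pdivrMl// -{1}(bij_inj bT Tx).
Qed.

Lemma invertible_bijective T : op_invertible T -> bijective T.
Proof. by move=> [S [_ TS ST]]; exists S. Qed.

Lemma bijective_invertible T : bounded_operator T -> bijective T ->
  op_invertible T.
Proof.
move=> bT bij; have [c c0 cT] := bijective_bounded_below bT bij.
have [g gT Tg] := bij.
have glin : linear g by apply: (can2_linear (f := T)).
pose G : {linear X -> X} := HB.pack g (GRing.isLinear.Build _ _ _ _ g glin).
exists G; split => //; apply/bounded_nearP.
exists c^-1; first by rewrite invr_gt0.
by move=> y; rewrite ler_pdivlMl// -{2}(Tg y).
Qed.

Lemma op_subE T l x : op_sub T l x = T x - l *: x.
Proof. by []. Qed.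

Lemma op_sub_bounded T l : bounded_operator T -> bounded_operator (op_sub T l).
Proof.
move=> /bounded_nearP[b b0 Tb]; apply/bounded_nearP.
exists (b + nm l); first by rewrite ltr_wpDr ?nm_ge0.
by move=> x; rewrite op_subE (le_trans (nmB _ _))// nmZ mulrDl lerD.
Qed.

(** The inverse is automatically bounded, so later arguments deal with bijectivity alone. *)
Lemma spectrumP T l : bounded_operator T ->
  spectrum T l <-> ~ bijective (op_sub T l).
Proof.
move=> bT; split => sT h; apply: sT; last exact: invertible_bijective.
by apply: bijective_invertible => //; exact: op_sub_bounded.
Qed.

Lemma op_sub_bijective_near T l : bounded_operator T ->
  bijective (op_sub T l) -> exists2 e : R, 0 < e &
    forall z, nm (z - l) < e -> bijective (op_sub T z).
Proof.
move=> bT bij.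
have [c c0 cT] := bijective_bounded_below (op_sub_bounded l bT) bij.
exists (c / 2); first by lra.
move=> z zl; apply: (perturbation_bijective c0 bij cT) => x.
rewrite !op_subE opprB addrC subrKA -scalerBl nmZ nm_distC.
by apply: ler_wpM2r; [exact: nm_ge0 | exact: ltW].
Qed.

(** [T - l] is a perturbation of [- l] times the identity; the factor 2 comes from the ratio 1/2 in
    [perturbation_bijective]. *)
Lemma op_sub_bijective_far T (b : R) l : 0 < b ->
  (forall x, nm (T x) <= b * nm x) -> 2 * b < nm l -> bijective (op_sub T l).
Proof.
move=> b0 Tb bl; have l0 : 0 < nm l by lra.
have l0' : l != 0 by rewrite -nm_gt0.
apply: (@perturbation_bijective (op_sub \0 l) _ (nm l)) => //.
- exists (fun x => - l^-1 *: x) => x; rewrite op_subE /= sub0r.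
    by rewrite scaleNr scalerN opprK scalerA mulVf ?scale1r.
  by rewrite scaleNr scalerN opprK scalerA divff ?scale1r.
- by move=> x; rewrite op_subE /= sub0r nmN nmZ.
move=> x; rewrite !op_subE /= sub0r opprK subrK.
by apply: (le_trans (Tb x)); apply: ler_wpM2r; [exact: nm_ge0 | lra].
Qed.

End Invertibility.

(** * Kato operators *)

Section Kato.
Context {R : realType}.

Lemma iter_linear (V : lmodType R[i]) (S : {linear V -> V}) n :
  linear (iter n S).
Proof. by elim: n => [|n IH] a x y //=; rewrite IH linearP. Qed.

Lemma iterD_linear (V : lmodType R[i]) (S : {linear V -> V}) n x y :
  iter n S (x + y) = iter n S x + iter n S y.
Proof. by have := iter_linear S n 1 x y; rewrite !scale1r. Qed.

Variable X : completeNormedModType R[i].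
Implicit Types S : {linear X -> X}.

(* A kernel vector [x] of [S] has preimages [x_n] under the powers of [S], with
   at most geometric growth, and [S - mu] almost kills [sum_n mu^n x_n]. *)
Lemma kato_bijective S : bounded_operator S -> kato S ->
  exists2 e : R, 0 < e &
    forall mu, nm mu < e -> bijective (op_sub S mu) -> bijective S.
Proof.
move=> bS [clS kS]; have [b b0 Sb] := (bounded_nearP S).1 bS.
have [C C0 HC] := open_mapping (@nmZ _ X) (@nmD _ X) (@complete_geometric _ X)
    Sb clS.
(* With [nm mu * C <= 1 / 4], the terms after the first in the series below add up to at most half
   of [nm x]. In the final perturbation, [nm mu] is below half of [3 / 4 * C^-1]. *)
exists (C^-1 / 4); first by rewrite divr_gt0// invr_gt0.
move=> mu mue bij.
have q4 : nm mu * C <= 1 / 4.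
  by apply/ltW; rewrite -ltr_pdivlMr// mulrC [ltRHS]mulrC mul1r mulrC.
have q0 : 0 <= nm mu * C by rewrite mulr_ge0 ?nm_ge0// ltW.
have [c c0 cT] := bijective_bounded_below (op_sub_bounded mu bS) bij.
have step x : exists x', op_range_infty S x ->
    [/\ S x' = x, nm x' <= C * nm x & op_range_infty S x'].
  have [rx|] := pselect (op_range_infty S x); last by exists 0.
  have [w _ /= Sw] := rx 1%N I; have [x'] := HC w; rewrite Sw => Sx' nx'.
  (* The Kato condition enters here: [x'] differs from [iter n S v] by a kernel vector, which lies
     in the range of [iter n S]. *)
  exists x' => _; split => // n _; have [v _ /= Sv] := rx n.+1 I.
  have [|z _ Sz] := kS (x' - iter n S v) _ n I.
    by rewrite /op_kernel /= opB Sx' Sv subrr.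
  by exists (z + v) => //; rewrite iterD_linear Sz subrK.
have [f Hf] := choice step.
have S0 x : S x = 0 -> x = 0.
  move=> Sx; have rx : op_range_infty S x by exact: kS.
  pose u n := iter n f x.
  have ru n : op_range_infty S (u n).
    by elim: n => // n IH; have [] := Hf _ IH.
  have Su n : S (u n.+1) = u n by have [] := Hf _ (ru n).
  have nu n : nm (u n) <= C ^+ n * nm x.
    elim: n => [|n IH]; first by rewrite expr0 mul1r.
    have [_ h _] := Hf _ (ru n); apply: (le_trans h); rewrite exprS -mulrA.
    by apply: ler_wpM2l => //; exact: ltW.
  have nmu n : nm (mu ^+ n *: u n) <= (nm mu * C) ^+ n * nm x.
    rewrite nmZ nmX exprMn -mulrA; apply: ler_wpM2l => //.
    by rewrite exprn_ge0 ?nm_ge0.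
  pose s n := \sum_(i < n.+1) mu ^+ i *: u i.
  have sS n : s n.+1 = s n + mu ^+ n.+1 *: u n.+1 by rewrite /s big_ord_recr.
  have Ss n : op_sub S mu (s n) = - (mu ^+ n.+1 *: u n).
    elim: n => [|n IH].
      by rewrite /s big_ord1 expr0 scale1r op_subE /= Sx sub0r expr1.
    rewrite sS (opD (op_sub S mu)) IH op_subE.
    by rewrite (opZ S) Su scalerA -exprS addKr.
  have q01 := half01 (R := R).
  have sD n : nm (s n.+1 - s n) <= nm x / 4 * 2^-1 ^+ n.
    rewrite sS addrC addKr.
    apply: (le_trans (nmu _)); rewrite exprS.
    have h1 : (nm mu * C) ^+ n <= 2^-1 ^+ n.
      by apply: lerXn2r; rewrite ?nnegrE//; lra.
    have h2 : 0 <= (nm mu * C) ^+ n by rewrite exprn_ge0.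
    have h3 : nm mu * C * (nm mu * C) ^+ n <= 1 / 4 * 2^-1 ^+ n by nra.
    by have := ler_wpM2r (nm_ge0 x) h3; lra.
  have sx n : nm x <= 2 * nm (s n).
    have := geometric_dist (nm0 X) (@nmN _ X) (@nmD _ X) q01 sD 0 n.
    rewrite add0n divr_half expr0 mulr1 {1}/s big_ord1 expr0 scale1r => h.
    by have := nmD (x - s n) (s n); rewrite subrK -/(u 0%N); lra.
  have small n : c * nm x <= 2 * nm mu * nm x * 2^-1 ^+ n.
    have := cT (s n); rewrite Ss nmN => h.
    apply: (@le_trans _ _ (2 * (c * nm (s n)))).
      by rewrite mulrCA; apply: ler_wpM2l; [exact: ltW | exact: sx].
    rewrite -!mulrA; apply: ler_wpM2l => //; apply: (le_trans h).
    rewrite exprS -scalerA nmZ; apply: ler_wpM2l; first exact: nm_ge0.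
    apply: (le_trans (nmu _)); rewrite mulrC.
    apply: ler_wpM2l; first exact: nm_ge0.
    by apply: lerXn2r; rewrite ?nnegrE//; lra.
  apply: nm_le0; rewrite -(pmulr_rle0 _ c0).
  exact: le_geometric0 small.
have Sbelow x : C^-1 * nm x <= nm (S x).
  rewrite ler_pdivrMl//; have [x' Sx' h] := HC x.
  suff xE : x' = x by rewrite -{1}xE.
  by apply/eqP; rewrite -subr_eq0; apply/eqP/S0; rewrite opB Sx' subrr.
have C'0 : 0 < C^-1 by rewrite invr_gt0.
have nx0 (x : X) := nm_ge0 x.
(* The bijective [S - mu] is the reference operator and [S] its perturbation. *)
apply: (perturbation_bijective (c := 3 / 4 * C^-1) _ bij) => [|x|x].
- by lra.
- have := nmD (op_sub S mu x) (mu *: x); rewrite {1}op_subE subrK nmZ => h.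
  have := Sbelow x; have : nm mu * nm x <= C^-1 / 4 * nm x.
    by apply: ler_wpM2r => //; exact: ltW.
  by lra.
rewrite op_subE opprB addrCA subrr addr0 nmZ; apply: ler_wpM2r => //; lra.
Qed.

End Kato.

(** * Fredholm operators *)

Section Span.
Context {K : pzRingType} {V : lmodType K}.
Implicit Types (s t : seq V) (x y : V).

(** The linear span of a list, peeled off one vector at a time to match the inductions that adjoin
    or remove one direction. *)
Fixpoint lspan s x : Prop :=
  if s is e :: s' then exists c : K, lspan s' (x - c *: e) else x = 0.

Lemma lspanD s x y : lspan s x -> lspan s y -> lspan s (x + y).
Proof.
elim: s x y => [|e s IH] x y /=; first by move=> -> ->; rewrite addr0.
move=> [a sa] [b sb]; exists (a + b).
by rewrite scalerDl opprD addrACA; exact: IH.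
Qed.

Lemma lspanZ s a x : lspan s x -> lspan s (a *: x).
Proof.
elim: s x => [|e s IH] x /=; first by move=> ->; rewrite scaler0.
by move=> [c sc]; exists (a * c); rewrite -scalerA -scalerBr; exact: IH.
Qed.

Lemma lspanB s x y : lspan s x -> lspan s y -> lspan s (x - y).
Proof. by move=> sx sy; apply: lspanD => //; rewrite -scaleN1r; exact: lspanZ. Qed.

Lemma lspan_cat s t x y : lspan s x -> lspan t y -> lspan (s ++ t) (x + y).
Proof.
elim: s x => [|e s IH] x /=; first by move=> ->; rewrite add0r.
by move=> [c sc] ty; exists c; rewrite addrAC; exact: IH.
Qed.

Lemma lspan_map (S : {linear V -> V}) s x :
  lspan s x -> lspan (map S s) (S x).
Proof.
elim: s x => [|e s IH] x /=; first by move=> ->; rewrite raddf0.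
by move=> [c /IH sc]; exists c; rewrite -linearZZ -raddfB.
Qed.

Lemma lspan_sum n (e : 'I_n -> V) (c : 'I_n -> K) :
  lspan [seq e i | i <- index_enum 'I_n] (\sum_(i < n) c i *: e i).
Proof.
elim: (index_enum _) => [|i r IH] /=; first by rewrite big_nil.
by exists (c i); rewrite big_cons addrAC subrr add0r.
Qed.

End Span.

(** Either all [P n] hold, or [P p] fails for some [p] and the implication is vacuous. *)
Lemma decreasing_stable (P : nat -> Prop) :
  (forall n, P n.+1 -> P n) -> exists p, forall n, (p <= n)%N -> P p -> P n.
Proof.
move=> dP; have [all|/existsNP[p nPp]] := pselect (forall n, P n).
  by exists 0%N.
by exists p.
Qed.

Lemma decreasing_le (T : Type) (V : nat -> set T) :
  (forall n x, V n.+1 x -> V n x) ->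
  forall m n x, (m <= n)%N -> V n x -> V m x.
Proof.
move=> dV m n x /subnK <-; elim: (n - m)%N => // k IH.
by rewrite addSn => /dV.
Qed.

(** Descending chain condition in a finite-dimensional space. A subspace of the span of [e :: s] is
    determined by its part in the span of [s] and, if there is one, a vector with coefficient 1 on
    [e]; both the part and the existence of the vector stabilise. *)
Lemma subspaces_stable (K : fieldType) (W : lmodType K) (s : seq W)
    (V : nat -> set W) :
  (forall n a x y, V n x -> V n y -> V n (a *: x + y)) ->
  (forall n x, V n.+1 x -> V n x) -> (forall x, V 0%N x -> lspan s x) ->
  exists p, forall n x, (p <= n)%N -> V p x -> V n x.
Proof.
elim: s V => [|e s IH] V linV dV V0 /=.
  have [p Hp] : exists p, forall n, (p <= n)%N -> V p 0 -> V n 0.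
    by apply: decreasing_stable => n; exact: dV.
  exists p => n x pn Vx.
  have x0 : x = 0 by apply: V0; exact: decreasing_le Vx.
  by move: Vx; rewrite x0; exact: Hp.
have [p1 H1] : exists p, forall n x, (p <= n)%N ->
    V p x /\ lspan s x -> V n x /\ lspan s x.
  apply: (IH (fun n => [set x | V n x /\ lspan s x])) => /=.
  - move=> n a x y [Vx sx] [Vy sy]; split; first exact: linV.
    by apply: lspanD => //; exact: lspanZ.
  - by move=> n x [Vx sx]; split => //; exact: dV.
  - by move=> x [].
have [p2 H2] : exists p, forall n, (p <= n)%N ->
    (exists2 x, V p x & lspan s (x - e)) ->
    (exists2 x, V n x & lspan s (x - e)).
  by apply: decreasing_stable => n [x Vx sx]; exists x => //; exact: dV.
exists (maxn p1 p2) => n x; rewrite geq_max => /andP[p1n p2n] Vx.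
have V1 : V p1 x by apply: decreasing_le Vx => //; exact: leq_maxl.
have V2 : V p2 x by apply: decreasing_le Vx => //; exact: leq_maxr.
have [c sc] : lspan (e :: s) x by apply: V0; exact: decreasing_le V1.
have [c0|c0] := eqVneq c 0.
  by move: sc; rewrite c0 scale0r subr0 => sx; case: (H1 n x p1n (conj V1 sx)).
have V0' k y a : V k y -> V k (a *: y).
  move=> Vy; have := linV k (a - 1) y y Vy Vy.
  by rewrite scalerBl scale1r subrK.
have [|x' Vx' sx'] := H2 n p2n.
  exists (c^-1 *: x); first exact: V0'.
  have -> : c^-1 *: x - e = c^-1 *: (x - c *: e).
    by rewrite scalerBr scalerA mulVf// scale1r.
  exact: lspanZ.
have sD : lspan s (x - c *: x').
  have -> : x - c *: x' = (x - c *: e) - c *: (x' - e).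
    by rewrite scalerBr opprB subrKA.
  by apply: lspanB => //; exact: lspanZ.
have VD : V p1 (x - c *: x').
  rewrite addrC -scaleNr; apply: linV => //.
  by apply: decreasing_le Vx'.
have [VnD _] := H1 n _ p1n (conj VD sD).
by rewrite -(subrK (c *: x') x) addrC; exact: linV.
Qed.

Section Codimension.
Context {R : realType} {X : completeNormedModType R[i]}.

(* The missing directions are adjoined to the domain one at a time. If [e] is not
   in the range of [T], the open mapping constant of [(y, c) |-> T y + c e] bounds
   the coefficient [c] of a point by its distance to the range of [T]. *)
Lemma finite_codim_closed (s : seq X) (Y : lmodType R[i]) (N : Y -> R)
    (T : {linear Y -> X}) (b : R) :
  (forall a y, N (a *: y) = nm a * N y) ->
  (forall x y, N (x + y) <= N x + N y) ->
  geometrically_complete N ->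
  (forall y, nm (T y) <= b * N y) ->
  (forall x, exists y, lspan s (x - T y)) -> closed (range T).
Proof.
elim: s Y N T b => [|e s IH] Y N T b NZ ND Nc Tb cod.
  rewrite (_ : range T = setT); first exact: closedT.
  rewrite -subTset => x _; have [y /eqP] := cod x.
  by rewrite subr_eq0 => /eqP ->; exists y.
have N0 : N 0 = 0 by rewrite -(scale0r (0 : Y)) NZ nm0 mul0r.
have NN y : N (- y) = N y by rewrite -scaleN1r NZ nmN nm1 mul1r.
have N_ge0 y : 0 <= N y by have := ND y (- y); rewrite subrr N0 NN; lra.
pose Y' : lmodType R[i] := (Y * R[i]^o)%type.
pose f (p : Y') : X := T p.1 + p.2 *: e.
have flin : linear f.
  move=> a x y; rewrite /f /= linearP scalerDr scalerA scalerDl.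
  by rewrite addrACA.
pose T' : {linear Y' -> X} := HB.pack f (GRing.isLinear.Build _ _ _ _ f flin).
pose N' (p : Y') := N p.1 + nm (p.2 : R[i]).
have N'Z a p : N' (a *: p) = nm a * N' p.
  by rewrite /N' /= NZ nmM mulrDr.
have N'D p p' : N' (p + p') <= N' p + N' p'.
  by have := ND p.1 p'.1; have := nmD p.2 p'.2; rewrite /N' /=; lra.
have N'c : geometrically_complete N'.
  apply: (@prod_geometric _ Y R[i] N (@nm R R[i])) => //.
  - exact: nm0.
  - exact: nmN.
  - exact: nmD.
  - exact: complex_geometric.
have T'b p : nm (T' p) <= (`|b| + nm e) * N' p.
  rewrite /T' /= /f; apply: (le_trans (nmD _ _)); rewrite nmZ /N'.
  have := Tb p.1; have := ler_wpM2r (N_ge0 p.1) (ler_norm b).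
  have : 0 <= nm e * N p.1 by rewrite mulr_ge0 ?nm_ge0.
  have : 0 <= `|b| * nm p.2 by rewrite mulr_ge0 ?nm_ge0.
  by rewrite (mulrC (nm p.2)) mulrDl !mulrDr; lra.
have clT' : closed (range T').
  apply: (IH _ _ _ _ N'Z N'D N'c T'b) => x; have [y [c sc]] := cod x.
  by exists (y, c); rewrite /= /f /= opprD addrA.
have [[y0 Ty0]|eT] := pselect (exists y, T y = e).
  rewrite (_ : range T = range T') //; apply/seteqP; split => [_ [y _ <-]|].
    by exists (y, 0) => //=; rewrite /f /= scale0r addr0.
  move=> _ [[y c] _ <-]; exists (y + c *: y0) => //.
  by rewrite /= /f /= raddfD /= linearZ /= Ty0.
have [C C0 HC] := open_mapping N'Z N'D N'c T'b clT'.
apply/closed_nmP => x clx.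
have [[y c] _ xE] : range T' x.
  apply: ((closed_nmP _).1 clT' x) => d d0; have [_ [y _ <-] h] := clx d d0.
  by exists (T y) => //; exists (y, 0) => //=; rewrite /f /= scale0r addr0.
have xE' : x = T y + c *: e by [].
suff /nm_le0 c0 : nm c <= 0.
  by exists y => //; rewrite xE' c0 scale0r addr0.
apply/ler_addgt0Pr => d d0; rewrite add0r.
have [_ [y' _ <-] h] := clx (d / C) (divr_gt0 d0 C0).
have [[y2 c2] E h2] := HC (y - y', c).
have E' : T y2 + c2 *: e = x - T y'.
  by rewrite -[LHS]/(T' (y2, c2)) E /= /f /= raddfB xE' addrAC.
(* Two different scalar coordinates would put [e] in the range of [T]. Hence the small preimage of
   [x - T y'] still has coordinate [c], which bounds [nm c] by [d]. *)
have cc : c2 = c.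
  apply: contrapT => /eqP ne; apply: eT; exists ((c2 - c)^-1 *: (y - y' - y2)).
  have A : T y - T y' = T y2 + c2 *: e - c *: e.
    by rewrite E' xE' addrAC addrK.
  rewrite (linearZZ T) (raddfB T) (raddfB T) /= A -(addrA (T y2)) (addrC (T y2)) addrK.
  by rewrite -scalerBl scalerA mulVf ?subr_eq0// scale1r.
have : N' (y2, c2) <= C * (d / C).
  apply: (le_trans h2); apply: ler_wpM2l; first exact: ltW.
  by rewrite -E -[X in nm X]/(T y2 + c2 *: e) E' ltW.
rewrite mulrC divfK ?gt_eqF// /N' /= cc; have := N_ge0 y2; lra.
Qed.

End Codimension.

(** * Closed subspaces and restrictions *)

Section Restriction.
Context {R : realType} {X : completeNormedModType R[i]}.
Implicit Types (T S : {linear X -> X}) (M : closedSubspace X) (V : set X).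

Lemma submod_asbool V : V 0 -> (forall a x y, V x -> V y -> V (a *: x + y)) ->
  GRing.submod_closed (fun x : X => `[<V x>]).
Proof.
move=> V0 VD; split; first by apply/asboolP.
by move=> a x y /asboolP Vx /asboolP Vy; apply/asboolP; exact: VD.
Qed.

Lemma closed_asbool V : closed V -> closed [set x : X | x \in (fun x => `[<V x>])].
Proof.
by rewrite (_ : [set x | _] = V)//; apply/seteqP; split => x /asboolP.
Qed.

Definition closed_subspace V (V0 : V 0)
  (VD : forall a x y, V x -> V y -> V (a *: x + y)) (cV : closed V) :=
  @ClosedSubspace _ X _ (submod_asbool V0 VD) (closed_asbool cV).

Lemma mem_closed_subspace V (V0 : V 0)
  (VD : forall a x y, V x -> V y -> V (a *: x + y)) (cV : closed V) x :
  x \in csub_pred (closed_subspace V0 VD cV) <-> V x.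
Proof. by split => [/asboolP|Vx]//; apply/asboolP. Qed.

(** Phrased inside [X], without [csubType] and without a proof of invariance. *)
Definition bijective_on (M : {pred X}) (f : X -> X) :=
  (forall x, x \in M -> f x = 0 -> x = 0) /\
  (forall y, y \in M -> exists2 x, x \in M & f x = y).

Lemma csub_val_inj M : injective (@csub_val _ _ M).
Proof. exact: val_inj. Qed.

Lemma restrict_bijectiveP T M (TM : invariant_subspace T M) z :
  bijective (op_sub (op_restrict TM) z) <->
  bijective_on (csub_pred M) (op_sub T z).
Proof.
have E (x : csubType M) :
    csub_val (op_sub (op_restrict TM) z x) = op_sub T z (csub_val x) by [].
split=> [bT|[T0 Ts]].
  split=> [x Mx Tx|y My].
    have /(congr1 (@csub_val _ _ M)) // : CsubType Mx = 0.
    by apply: (bijective_ker0 bT); apply: csub_val_inj; rewrite E.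
  have [[x Mx] /(congr1 (@csub_val _ _ M)) /= h] :=
    bijective_surj bT (CsubType My).
  by exists x.
apply: linear_bijective => [[x Mx] Tx|[y My]].
  apply: csub_val_inj; apply: T0 => //.
  by rewrite -[LHS](E (CsubType Mx)) Tx.
have [x Mx Tx] := Ts y My.
by exists (CsubType Mx); apply: csub_val_inj; rewrite E.
Qed.

Lemma op_restrict_bounded T M (TM : invariant_subspace T M) :
  bounded_operator T -> bounded_operator (op_restrict TM).
Proof.
move=> /bounded_nearP[b b0 Tb]; apply/bounded_nearP; exists b => // x.
exact: (Tb (csub_val x)).
Qed.

End Restriction.

(** * Punctured disks around a point of decomposition *)

Section Dichotomy.
Context {R : realType}.

Definition punctured_dichotomy (X : completeNormedModType R[i])
    (S : {linear X -> X}) :=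
  exists2 e : R, 0 < e &
    (forall mu, 0 < nm mu < e -> bijective (op_sub S mu)) \/
    (forall mu, 0 < nm mu < e -> ~ bijective (op_sub S mu)).

Lemma op_sub0_bijective (X : completeNormedModType R[i]) (S : {linear X -> X}) :
  bijective (op_sub S 0) <-> bijective S.
Proof.
by split=> h; apply: (eq_bij h) => x; rewrite op_subE scale0r subr0.
Qed.

Lemma kato_dichotomy (X : completeNormedModType R[i]) (S : {linear X -> X}) :
  bounded_operator S -> kato S -> punctured_dichotomy S.
Proof.
move=> bS kS; have [e e0 He] := kato_bijective bS kS.
have [bijS|nbijS] := pselect (bijective S).
  have [d d0 Hd] := op_sub_bijective_near bS ((op_sub0_bijective S).2 bijS).
  by exists d => //; left => mu /andP[_ mud]; apply: Hd; rewrite subr0.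
by exists e => //; right => mu /andP[_ mue] bij; apply: nbijS; exact: He bij.
Qed.

Lemma iter_op_sub (X : completeNormedModType R[i]) (S : {linear X -> X}) mu n x :
  op_sub S mu (iter n S x) = iter n S (op_sub S mu x).
Proof.
have E := iter_linear S n (- mu) x (S x).
rewrite !op_subE (addrC (S x)) -[in RHS]scaleNr E scaleNr addrC.
by rewrite -iterSr.
Qed.

(** If [s] spans modulo the range of [S] and [t] modulo that of [iter p S], then [map S t ++ s]
    spans modulo that of the next power. This makes the ranges of all powers closed. *)
Lemma fredholm_range_power (X : completeNormedModType R[i])
    (S : {linear X -> X}) (m : nat) :
  has_codim (range S) m -> forall p, exists s : seq X,
    forall x, exists y, lspan s (x - iter p S y).
Proof.
move=> [e He].
have [s Hs] : exists s : seq X, forall x, exists y, lspan s (x - S y).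
  exists [seq e i | i <- index_enum 'I_m] => x.
  have [c [[y _ Sy] _]] := He x; exists y.
  by rewrite Sy opprB addrC subrK; exact: lspan_sum.
elim=> [|p [t Ht]]; first by exists [::] => x; exists x; rewrite /= subrr.
exists (map S t ++ s) => x; have [a xa] := Hs x; have [y ay] := Ht a.
exists y; rewrite iterS -(subrKA (S a)) -opB addrC.
by apply: lspan_cat => //; exact: lspan_map.
Qed.

Lemma fredholm_dichotomy (X : completeNormedModType R[i]) (S : {linear X -> X}) :
  bounded_operator S -> fredholm S -> punctured_dichotomy S.
Proof.
move=> bS [[n [e [Ne He]]] [m codS]].
(* The intersections of the kernel with the ranges of the powers decrease in a finite-dimensional
   space. Their stability from [p] on is the kernel condition for the restriction of [S] to the
   range of [iter p S]. *)
have [p Hp] : exists p, forall k x, (p <= k)%N ->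
    op_kernel S x /\ range (iter p S) x -> op_kernel S x /\ range (iter k S) x.
  apply: (@subspaces_stable _ _ [seq e i | i <- index_enum 'I_n]
    (fun k => [set x | op_kernel S x /\ range (iter k S) x])).
  - move=> k a x y [Nx [x' _ xE]] [Ny [y' _ yE]]; split.
      move: Nx Ny; rewrite /op_kernel /= opD opZ => -> ->.
      by rewrite scaler0 addr0.
    by exists (a *: x' + y') => //; rewrite iter_linear xE yE.
  - move=> k x [Nx [y _ yE]]; split => //; exists (S y) => //.
    by rewrite -iterSr.
  - move=> x [Nx _]; have [c [-> _]] := He x Nx; exact: lspan_sum.
have [b b0 Sb] := (bounded_nearP S).1 bS.
have iterb k x : nm (iter k S x) <= b ^+ k * nm x.
  elim: k => [|k IH]; first by rewrite expr0 mul1r.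
  rewrite iterS exprS -mulrA; apply: (le_trans (Sb _)).
  by apply: ler_wpM2l => //; exact: ltW.
have clS k : closed (range (iter k S)).
  have [s Hs] := fredholm_range_power codS k.
  pose Sk : {linear X -> X} :=
    HB.pack (iter k S) (GRing.isLinear.Build _ _ _ _ _ (iter_linear S k)).
  exact: (@finite_codim_closed _ _ s _ _ Sk _ (@nmZ _ X) (@nmD _ X)
    (@complete_geometric _ X) (iterb k)).
have Z0 : range (iter p S) 0 by exists 0 => //; elim: (p) => //= k ->; rewrite op0.
have ZD a x y : range (iter p S) x -> range (iter p S) y ->
    range (iter p S) (a *: x + y).
  by move=> [x' _ <-] [y' _ <-]; exists (a *: x' + y') => //; rewrite iter_linear.
pose Z := closed_subspace Z0 ZD (clS p).
have ZP x : x \in csub_pred Z <-> range (iter p S) x by exact: mem_closed_subspace.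
have SZ : invariant_subspace S Z.
  by move=> x /ZP[y _ <-]; apply/ZP; exists (S y) => //; rewrite -iterSr.
pose SZo := op_restrict SZ.
have SZit k (x : csubType Z) : csub_val (iter k SZo x) = iter k S (csub_val x).
  by elim: k => //= k <-.
have kZ : kato SZo.
  split.
    apply/closed_nmP => x clx.
    (* The range of the restriction is that of one more power of [S]. *)
    have [w _ wx] : range (iter p.+1 S) (csub_val x).
      apply: ((closed_nmP _).1 (clS p.+1)) => d d0.
      have [_ [y _ <-] h] := clx d d0; exists (S (csub_val y)) => //.
      by have /ZP[w _ <-] := csub_valP y; exists w.
    have Zw : iter p S w \in csub_pred Z by apply/ZP; exists w.
    by exists (CsubType Zw) => //; apply: csub_val_inj.
  move=> x Sx k _; have Nx : op_kernel S (csub_val x).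
    by have := congr1 (@csub_val _ _ Z) Sx.
  have [|_ [w _ wx]] := Hp (k + p)%N (csub_val x) (leq_addl _ _).
    by split => //; apply/ZP; exact: csub_valP.
  have Zw : iter p S w \in csub_pred Z by apply/ZP; exists w.
  exists (CsubType Zw) => //; apply: csub_val_inj.
  by rewrite SZit /= -iterD.
have bZ : bounded_operator SZo by exact: op_restrict_bounded.
have toZ mu : bijective (op_sub S mu) -> bijective (op_sub SZo mu).
  move=> bij; apply/restrict_bijectiveP; split => [x _|_ /ZP[w _ <-]].
    exact: bijective_ker0.
  have [v <-] := bijective_surj bij w; exists (iter p S v).
    by apply/ZP; exists v.
  exact: iter_op_sub.
have fromZ mu : mu != 0 -> bijective (op_sub SZo mu) -> bijective (op_sub S mu).
  move=> mu0 /restrict_bijectiveP[inj surj]; apply: linear_bijective => [x Sx|y].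
    apply: inj => //; apply/ZP.
    (* An eigenvector for [mu != 0] lies in the range of every power. *)
    have itx k : iter k S x = mu ^+ k *: x.
      elim: k => [|k IH] /=; first by rewrite expr0 scale1r.
      move/eqP: Sx; rewrite op_subE subr_eq0 => /eqP Sx.
      by rewrite IH opZ Sx scalerA exprSr.
    exists (mu ^- p *: x) => //.
    rewrite -[mu ^- p *: x]addr0 iter_linear itx scalerA mulVf ?expf_neq0//.
    by rewrite scale1r (_ : iter p S 0 = 0) ?addr0//; elim: (p) => //= k ->; rewrite op0.
  (* [S - mu] divides [S^p - mu^p]; as [S^p y] has a preimage [z] under [S - mu], so has [mu^p y],
     namely [z - q]. *)
  have [q Hq] : exists q, op_sub S mu q = iter p S y - mu ^+ p *: y.
    elim: (p) => [|k [q Hq]]; first by exists 0; rewrite op0 expr0 scale1r subrr.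
    exists (S q + mu ^+ k *: y).
    rewrite opD opZ.
    have -> : op_sub S mu (S q) = S (op_sub S mu q) by exact: (iter_op_sub S mu 1 q).
    by rewrite Hq op_subE opB opZ scalerBr subrKA scalerA -exprSr.
  have [|z _ Sz] := surj (iter p S y); first by apply/ZP; exists y.
  exists (mu ^- p *: (z - q)); rewrite (opZ (op_sub S mu)) (opB (op_sub S mu)).
  rewrite Sz Hq opprB addrC subrK.
  by rewrite scalerA mulVf ?scale1r// expf_neq0.
have [e0 e00 [H|H]] := kato_dichotomy bZ kZ; exists e0 => //.
  left => mu mue; apply: fromZ; last exact: H.
  by rewrite -nm_gt0; case/andP: mue.
by right => mu /H nb /toZ.
Qed.

(** For [mu != 0] the quasi-nilpotent summand minus [mu] is bijective, so the first summand alone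
    decides; this is why the disks are punctured. *)
Lemma pseudo_dichotomy (P : forall Y : completeNormedModType R[i],
    {linear Y -> Y} -> Prop) (X : completeNormedModType R[i])
    (T : {linear X -> X}) :
  (forall (Y : completeNormedModType R[i]) (S : {linear Y -> Y}),
    bounded_operator S -> P Y S ->
    punctured_dichotomy S) ->
  bounded_operator T -> pseudo P T -> punctured_dichotomy T.
Proof.
move=> HP bT [X1 [X2 [T1 [T2 [[dec indep] P1 qn2]]]]].
have T1E (mu : R[i]) : mu != 0 ->
    bijective (op_sub (op_restrict T1) mu) <-> bijective (op_sub T mu).
  move=> mu0.
  have /restrict_bijectiveP[inj2 surj2] : bijective (op_sub (op_restrict T2) mu).
    apply: contrapT => nb; move/eqP: mu0; apply; apply: qn2.
    by move=> /invertible_bijective.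
  have op0D M (TM : invariant_subspace T M) x : x \in csub_pred M ->
      op_sub T mu x \in csub_pred M.
    move=> Mx; have [M0 MD] := csub_submod M.
    by rewrite op_subE addrC -scaleNr; apply: MD => //; exact: TM.
  rewrite restrict_bijectiveP; split=> [[inj1 surj1]|bij].
    apply: linear_bijective => [x Tx|y].
      have [x1 [x2 [X1x1 X2x2 xE]]] := dec x.
      move: Tx; rewrite xE (opD (op_sub T mu)) => /eqP; rewrite addr_eq0 => /eqP Tx.
      have Tx1 : op_sub T mu x1 = 0.
        apply: indep; first exact: op0D.
        have [M0 MD] := csub_submod X2.
        rewrite Tx -scaleN1r -[_ *: _]addr0; apply: MD => //; exact: op0D.
      have Tx2 : op_sub T mu x2 = 0 by apply: oppr_inj; rewrite -Tx Tx1 oppr0.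
      by rewrite (inj1 _ X1x1 Tx1) (inj2 _ X2x2 Tx2) addr0.
    have [y1 [y2 [/surj1[x1 _ <-] /surj2[x2 _ <-] ->]]] := dec y.
    by exists (x1 + x2); rewrite (opD (op_sub T mu)).
  split=> [x _|y1 X1y1]; first exact: bijective_ker0.
  have [x Tx] := bijective_surj bij y1.
  have [x1 [x2 [X1x1 X2x2 xE]]] := dec x.
  exists x1 => //; have [M0 MD] := csub_submod X1.
  have : op_sub T mu x2 = 0.
    apply: indep; last exact: op0D.
    have -> : op_sub T mu x2 = (-1) *: op_sub T mu x1 + y1.
      by rewrite -Tx xE (opD (op_sub T mu)) scaleN1r addKr.
    by apply: MD => //; exact: op0D.
  by rewrite -Tx xE (opD (op_sub T mu)) => ->; rewrite addr0.
have [e e0 H] := HP _ _ (op_restrict_bounded T1 bT) P1; exists e => //.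
have ne (mu : R[i]) : 0 < nm mu < e -> mu != 0 by rewrite -nm_gt0 => /andP[].
case: H => H; [left|right] => mu mue.
  by apply/(T1E mu (ne mu mue)); exact: H.
by move/(T1E mu (ne mu mue)); exact: H.
Qed.

End Dichotomy.

(** * Finiteness of the spectrum *)

Section ComplexPlane.
Context {R : realType}.
Implicit Types (P : set R[i] -> Prop) (A B : set R[i]).

(* Compactness in the form of near coverings, applied to the filter of the
   families of sets containing all supersets of some set satisfying [P]. *)
Lemma disk_local_to_global P (r : R) :
  (forall A B, A `<=` B -> P B -> P A) -> P set0 ->
  (forall A B, P A -> P B -> P (A `|` B)) ->
  (forall z, exists2 e : R, 0 < e & P [set w | nm (w - z) < e]) ->
  P [set z | nm z <= r].
Proof.
move=> Psub P0 PU Ploc.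
pose F : set_system (set R[i]) :=
  [set G | exists2 B, P B & forall E, B `<=` E -> G E].
have FF : Filter F.
  split; first by exists set0.
  - move=> G H [B PB GB] [C PC HC]; exists (B `|` C); first exact: PU.
    by move=> E BCE; split; [apply: GB | apply: HC] => x ?; apply: BCE; [left | right].
  - by move=> G H GH [B PB GB]; exists B => // E /GB /GH.
pose K : set (R * R) := `[- r, r] `*` `[- r, r].
have cK : compact K by apply: compact_setX; exact: segment_compact.
have /compact_near_coveringP cov := cK.
have [|B PB HB] := cov _ F (fun E x => E (x.1 +i* x.2)%C) FF.
  move=> [a b] _ /=; have [e e0 Pe] := Ploc (a +i* b)%C.
  (* Radius [e / 2] in each coordinate, as the modulus is at most the sum of the absolute values of
     the real and imaginary parts. *)
  exists (ball (a, b) (e / 2), [set E | [set w | nm (w - (a +i* b)%C) < e] `<=` E]).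
    split; first by apply: nbhsx_ballx; rewrite divr_gt0.
    by exists [set w | nm (w - (a +i* b)%C) < e].
  move=> [[a' b'] E] /= [[ha hb] sub]; apply: sub => /=.
  apply: le_lt_trans (nm_le_ReIm _) _ => /=.
  by move: ha hb; rewrite /ball /= distrC => ha; rewrite distrC => hb; lra.
apply: Psub (PB) => -[a b] /= ab.
apply: (HB B (@subset_refl _ B) (a, b)); rewrite /K /= !in_itv /= -!ler_norml.
split; apply: le_trans ab.
  exact: (norm_Re_le (a +i* b)%C).
exact: (norm_Im_le (a +i* b)%C).
Qed.

Definition complex_open A :=
  forall z, A z -> exists2 e : R, 0 < e & forall w, nm (w - z) < e -> A w.

(** On the segment from [z0] to [z], parametrised by [[0, 1]], the preimage of [A] is open and, as
    the complement of that of [B], also closed. *)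
Lemma complex_connected A B : complex_open A -> complex_open B ->
  (forall z, A z \/ B z) -> (forall z, A z -> ~ B z) ->
  forall z0 z, A z0 -> A z.
Proof.
move=> oA oB AB AnB z0 z Az0.
pose g (t : R) := z0 + t%:C%C * (z - z0).
have openg C : complex_open C -> open (g @^-1` C).
  move=> oC; rewrite openE => t /= /oC[e e0 He].
  have d0 : 0 < nm (z - z0) + 1 by rewrite ltr_wpDl ?nm_ge0.
  apply/nbhs_ballP; exists (e / (nm (z - z0) + 1)) => /=.
    by rewrite divr_gt0.
  move=> s /=; rewrite -ball_normE /ball_ /= ltr_pdivlMr// => h; apply: He.
  rewrite /g opprD addrACA subrr add0r -mulrBl nmM -rmorphB nmR distrC.
  apply: le_lt_trans h; apply: ler_wpM2l => //; lra.
pose I01 := [set` `[0 : R, 1]].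
have E : I01 `&` (g @^-1` A) = I01.
  apply: (@segment_connected R 0 1).
  - exists 0; split => /=; first by rewrite /I01 /= in_itv /= lexx ler01.
    by rewrite /g mul0r addr0.
  - by exists (g @^-1` A) => //; exact: openg.
  - exists (~` (g @^-1` B)); first by rewrite closedC; exact: openg.
    apply/seteqP; split => t [t01 h]; split => //; first exact: AnB.
    by case: (AB (g t)).
have [_] : (I01 `&` (g @^-1` A)) 1 by rewrite E /I01 /= in_itv /= lexx ler01.
by rewrite /g /= mul1r addrC subrK.
Qed.

Definition punctured_near (A : set R[i]) (z : R[i]) :=
  exists2 e : R, 0 < e & forall w, 0 < nm (w - z) < e -> A w.

Lemma punctured_near_open A : complex_open (punctured_near A).
Proof.
move=> z [e e0 He]; exists e => // w wz.
have [->|nwz] := eqVneq w z; first by exists e.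
have d0 : 0 < nm (w - z) by rewrite nm_gt0 subr_eq0.
(* The first bound keeps the new disk inside the old one, the second keeps it away from [z]. *)
exists (Num.min (e - nm (w - z)) (nm (w - z))); first by rewrite lt_min subr_gt0 wz.
move=> v /andP[vw0]; rewrite lt_min => /andP[h1 h2]; apply: He.
have := nmD (v - w) (w - z); have := nmD (v - z) (w - v).
rewrite subrKA addrC subrKA (nm_distC w v) => h3 h4.
by apply/andP; split; lra.
Qed.

Lemma punctured_near_disjoint A z : punctured_near A z ->
  ~ punctured_near (~` A) z.
Proof.
move=> [d d0 Hd] [e e0 He].
pose m := Num.min d e / 2.
have [m0 md me] : [/\ 0 < m, m < d & m < e].
  rewrite /m; case: (leP d e) => h; split; lra.
have mE : nm (z + m%:C%C - z) = m by rewrite addrC addKr nmR gtr0_norm.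
by apply: (He (z + m%:C%C)); [|apply: Hd]; rewrite mE m0.
Qed.

Lemma finite_isolated A z : finite_set A ->
  exists2 r : R, 0 < r & forall w, 0 < nm (w - z) <= r -> ~ A w.
Proof.
move=> /finite_seqP[s ->]; elim: s => [|a s [r r0 Hr]]; first by exists 1.
have [->|az] := eqVneq a z.
  exists r => // w wz; rewrite /= inE => /orP[/eqP wz'|]; last exact: Hr.
  by move: wz; rewrite wz' subrr nm0 ltxx.
have d0 : 0 < nm (a - z) by rewrite nm_gt0 subr_eq0.
exists (Num.min r (nm (a - z) / 2)); first by rewrite lt_min r0 divr_gt0.
move=> w /andP[w0]; rewrite le_min => /andP[wr wa].
rewrite /= inE => /orP[/eqP wE|]; first by move: wa; rewrite wE; lra.
by apply: Hr; rewrite w0.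
Qed.

Lemma op_sub_op_sub_bijective (X : completeNormedModType R[i])
    (T : {linear X -> X}) l m :
  bijective (op_sub (op_sub T l) (m - l)) <-> bijective (op_sub T m).
Proof.
have E : op_sub (op_sub T l) (m - l) =1 op_sub T m.
  by move=> x; rewrite !op_subE scalerBl opprB addrA subrK.
by split=> h; apply: (eq_bij h) => x; rewrite E.
Qed.

Lemma dichotomy_spectrum_finite (X : completeNormedModType R[i])
    (T : {linear X -> X}) : bounded_operator T ->
  (forall l, punctured_dichotomy (op_sub T l)) -> finite_set (spectrum T).
Proof.
move=> bT dich; pose A := [set z | bijective (op_sub T z)].
have cases z : punctured_near A z \/ punctured_near (~` A) z.
  have [e e0 [H|H]] := dich z; [left | right]; exists e => // w wz.
    by apply/(op_sub_op_sub_bijective T z w); exact: H.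
  by move/(op_sub_op_sub_bijective T z w); exact: H.
have [b b0 Tb] := (bounded_nearP T).1 bT.
have far z : 2 * b < nm z -> A z by exact: op_sub_bijective_far.
have allA z : punctured_near A z.
  (* The unit disk around the starting point [2 * b + 1] lies in the region covered by [far]. *)
  apply: (complex_connected (@punctured_near_open A)
    (@punctured_near_open (~` A)) cases (@punctured_near_disjoint A)
    (z0 := (2 * b + 1)%:C%C)).
  exists 1 => // w /andP[_ h]; apply: far.
  have := nmD w ((2 * b + 1)%:C%C - w); rewrite addrC subrK nm_distC nmR.
  by rewrite gtr0_norm; lra.
apply: (@sub_finite_set _ _ ([set z | nm z <= 2 * b] `&` ~` A)).
  move=> z /(spectrumP z bT) nb; split => //=.
  by rewrite leNgt; apply/negP => /far.
apply: (@disk_local_to_global (fun E => finite_set (E `&` ~` A))).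
- by move=> E F EF; apply: sub_finite_set; exact: setSI.
- by rewrite set0I; exact: finite_set0.
- by move=> E F fE fF; rewrite setIUl finite_setU.
move=> z; have [e e0 He] := allA z; exists e => //.
apply: (@sub_finite_set _ _ [set z]); last exact: finite_set1.
move=> w [/= wz nAw]; apply: contrapT => nwz; apply: nAw; apply: He.
by rewrite wz andbT nm_gt0 subr_eq0; apply/eqP.
Qed.

End ComplexPlane.

(** * Riesz decomposition *)

Section Resolvents.
Context {R : realType} {X : completeNormedModType R[i]}.
Implicit Types (A B : {linear X -> X}) (g : X -> X) (u v : R[i]).

Definition inverts_1sub B u g :=
  (forall x, g (x - u *: B x) = x) /\ (forall x, g x - u *: B (g x) = x).

Lemma scale_halfD (x : X) : 2^-1 *: (x + x) = x.
Proof.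
by rewrite -mulr2n -(scaler_nat 2 x) scalerA mulVf ?scale1r// pnatr_eq0.
Qed.

Lemma sub_scale_linear B u : linear (fun x => x - u *: B x).
Proof.
move=> a x y; rewrite opD opZ scalerDr opprD addrACA; congr (_ + _).
by rewrite scalerBr !scalerA mulrC.
Qed.

Lemma inverts_linear B u g : inverts_1sub B u g -> linear g.
Proof.
move=> [gB Bg] a x y; rewrite -[RHS]gB; congr g.
by rewrite sub_scale_linear !Bg.
Qed.

Lemma inverts_comm B u g (f : X -> X) : inverts_1sub B u g -> linear f ->
  (forall x, f (B x) = B (f x)) -> forall x, g (f x) = f (g x).
Proof.
move=> [gB Bg] fl fB x; rewrite -[RHS]gB; congr g.
rewrite -fB -{1}[x]Bg addrC -scaleNr fl scaleNr addrC //.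
Qed.

Lemma inverts_unique B u g h : inverts_1sub B u g -> inverts_1sub B u h -> g =1 h.
Proof. by move=> [gB _] [_ Bh] x; rewrite -{1}[x]Bh gB. Qed.

Lemma sub_sqr_factor B v x :
  x - v ^+ 2 *: B (B x) = (x - v *: B x) - (- v) *: B (x - v *: B x).
Proof.
rewrite (opB B) (opZ B) scaleNr opprK scalerBr addrA subrK.
by rewrite scalerA expr2.
Qed.

Lemma sub_sqr_factorN B v x :
  x - v ^+ 2 *: B (B x) = (x + v *: B x) - v *: B (x + v *: B x).
Proof. by rewrite -sqrrN sub_sqr_factor opprK scaleNr opprK. Qed.

(* [1 - u B^2] factors as [(1 - v B) (1 + v B)] when [v^2 = u]; its inverse is both
   the product and the mean of the inverses of the two factors. *)
Lemma inverts_sqr_mean B v g h :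
  inverts_1sub B v g -> inverts_1sub B (- v) h ->
  inverts_1sub (B \o B) (v ^+ 2) (fun x => 2^-1 *: (g x + h x)).
Proof.
move=> [gB Bg] [hB Bh].
split=> x /=.
  rewrite {1}sub_sqr_factorN gB sub_sqr_factor hB.
  by rewrite addrACA subrr addr0 scale_halfD.
have gE : g x - v ^+ 2 *: B (B (g x)) = x + v *: B x.
  by rewrite sub_sqr_factor Bg scaleNr opprK.
have hE : h x - v ^+ 2 *: B (B (h x)) = x - v *: B x.
  by rewrite sub_sqr_factorN -[v *: B (h x)]opprK -scaleNr Bh.
rewrite !(opZ B) !(opD B) scalerA mulrC -scalerA -scalerBr (scalerDr (v ^+ 2)) opprD.
by rewrite addrACA gE hE addrACA subrr addr0 scale_halfD.
Qed.

Lemma inverts_sqr_comp B v g h :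
  inverts_1sub B v g -> inverts_1sub B (- v) h ->
  inverts_1sub (B \o B) (v ^+ 2) (fun x => g (h x)).
Proof.
move=> [gB Bg] [hB Bh].
split=> x /=; first by rewrite sub_sqr_factor hB gB.
by rewrite sub_sqr_factor Bg Bh.
Qed.

End Resolvents.

(** * The limit of the inverses of [1 - A^(2^k)] *)

Section SpectralProjection.
Context {R : realType} {X : completeNormedModType R[i]}.
Implicit Types (A B : {linear X -> X}) (u v : R[i]).

(** [M] bounds the inverses on the unit circle and [L] is their Lipschitz constant; squaring [B]
    keeps [M] and contracts [L]. *)
Definition resolvent_family B (G : R[i] -> X -> X) (M L : R) :=
  forall u, nm u = 1 -> [/\ inverts_1sub B u (G u),
    forall x, nm (G u x) <= M * nm x &
    forall u', nm u' = 1 -> forall x,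
      nm (G u x - G u' x) <= L * nm (u - u') * nm x].

Lemma circle_bounded_below A : bounded_operator A ->
  (forall u, nm u = 1 -> bijective (op_sub A u)) ->
  exists2 c : R, 0 < c & forall u, nm u = 1 ->
    forall x, c * nm x <= nm (x - u *: A x).
Proof.
move=> bA bij; have [a a0 Aa] := (bounded_nearP A).1 bA.
pose P (E : set R[i]) := exists2 c : R, 0 < c & forall u, E u -> nm u = 1 ->
  forall x, c * nm x <= nm (x - u *: A x).
suff [c c0 Hc] : P [set u | nm u <= 1].
  by exists c => // u u1; apply: Hc => //=; rewrite u1.
apply: disk_local_to_global.
- by move=> E F EF [c c0 Hc]; exists c => // u /EF; exact: Hc.
- by exists 1.
- move=> E F [c c0 Hc] [d d0 Hd]; exists (Num.min c d); first by rewrite lt_min c0.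
  by move=> u [Eu|Fu] u1 x; [apply: le_trans (Hc u Eu u1 x)
    |apply: le_trans (Hd u Fu u1 x)]; apply: ler_wpM2r;
    rewrite ?nm_ge0// ge_min lexx ?orbT.
move=> z; have [z1|z1] := eqVneq (nm z) 1; last first.
  (* Off the circle, a disk that misses the circle makes the claim vacuous. *)
  exists `|nm z - 1|; first by rewrite normr_gt0 subr_eq0.
  exists 1 => // w /= wz w1.
  have := nmD (z - w) w; have := nmD (w - z) z; rewrite !subrK w1 (nm_distC z).
  by move=> h3 h4; exfalso; move: wz; case: (ger0P (nm z - 1)) => h1 h2; lra.
have z0 : z != 0 by rewrite -nm_gt0 z1.
have zV : nm z^-1 = 1 by rewrite nmV z1 invr1.
have [c c0 Hc] := bijective_bounded_below (op_sub_bounded z^-1 bA) (bij _ zV).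
(* At this distance the change [(w - z) *: A x] costs at most half of the lower bound [c]. *)
exists (c / (2 * a)); first by rewrite divr_gt0// mulr_gt0.
exists (c / 2) => [|w /= wz w1 x]; first by lra.
have h1 : c * nm x <= nm (x - z *: A x).
  apply: (le_trans (Hc x)); rewrite -[leLHS]mul1r -z1 -nmZ op_subE scalerBr.
  by rewrite scalerA divff// scale1r nm_distC.
have h2 := nmD (x - w *: A x) ((w - z) *: A x).
have h3 : nm ((w - z) *: A x) <= c / 2 * nm x.
  rewrite nmZ; apply: (@le_trans _ _ (c / (2 * a) * (a * nm x))).
    by apply: ler_pM; rewrite ?nm_ge0 ?(ltW wz)// Aa.
  by rewrite mulrA le_eqVlt; apply/orP; left; apply/eqP; field; rewrite gt_eqF.
have E : x - w *: A x + (w - z) *: A x = x - z *: A x by rewrite scalerBl subrKA.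
by move: h2; rewrite E; lra.
Qed.

Lemma resolvent_family0 A : bounded_operator A ->
  (forall u, nm u = 1 -> bijective (op_sub A u)) ->
  exists G M L, [/\ 0 <= M, 0 <= L & resolvent_family A G M L].
Proof.
move=> bA bij; have [a a0 Aa] := (bounded_nearP A).1 bA.
have [c c0 Hc] := circle_bounded_below bA bij.
have inv u : exists g, nm u = 1 -> inverts_1sub A u g.
  have [u1|] := pselect (nm u = 1); last by exists id.
  have u0 : u != 0 by rewrite -nm_gt0 u1.
  have [g gA Ag] : bijective (op_sub A u^-1) by apply: bij; rewrite nmV u1 invr1.
  have E x : x - u *: A x = - u *: op_sub A u^-1 x.
    by rewrite op_subE scaleNr scalerBr scalerA divff// scale1r opprB.
  have uN0 : - u != 0 by rewrite oppr_eq0.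
  exists (fun x => g ((- u)^-1 *: x)) => _; split => x.
    by rewrite E scalerA mulVf// scale1r gA.
  by rewrite E Ag scalerA mulfV// scale1r.
have [G HG] := choice inv.
exists G, c^-1, (c^-1 * a * c^-1).
have cV : 0 <= c^-1 by rewrite invr_ge0 ltW.
split => //; first by rewrite !mulr_ge0// ltW.
have Gb u x : nm u = 1 -> nm (G u x) <= c^-1 * nm x.
  move=> u1; rewrite ler_pdivlMl//; apply: (le_trans (Hc u u1 _)).
  by have [_ ->] := HG u u1.
move=> u u1; split => //; first exact: HG; first by move=> x; exact: Gb.
move=> u' u1' x.
have [gA Ag] := HG u u1; have [gA' Ag'] := HG u' u1'.
have gl := inverts_linear (HG u u1).
have gB y z : G u y - G u z = G u (y - z).
  by rewrite addrC -scaleN1r -gl scaleN1r addrC.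
(* The resolvent identity, from which the Lipschitz constant is read off. *)
have -> : G u x - G u' x = G u ((u - u') *: A (G u' x)).
  transitivity (G u (G u' x - u' *: A (G u' x)) - G u (G u' x - u *: A (G u' x))).
    by rewrite Ag' gA.
  by rewrite gB opprB (addrC (G u' x - _)) subrKA scalerBl.
apply: (le_trans (Gb _ _ u1)); rewrite -!mulrA; apply: ler_wpM2l => //.
rewrite nmZ.
have h := ler_wpM2l (nm_ge0 (u - u')) (Aa (G u' x)).
have h' := ler_wpM2l (nm_ge0 (u - u')) (ler_wpM2l (ltW a0) (Gb _ x u1')).
by apply: (le_trans h); apply: (le_trans h'); lra.
Qed.

Lemma nm_sqrtC u : nm u = 1 -> nm (sqrtC u) = 1.
Proof.
move=> u1; have : nm (sqrtC u) ^+ 2 = 1 by rewrite -nmX sqrtCK.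
by move/eqP; rewrite sqrf_eq1 => /orP[/eqP//|/eqP h]; have := nm_ge0 (sqrtC u); lra.
Qed.

(* The two square roots of [u] can be paired with those of [u'] so as to be at
   distance at most 3/4 times the distance from [u] to [u'] (any constant larger
   than 1/sqrt 2 would do), hence the contraction of the Lipschitz constant. *)
Lemma resolvent_family_sqr B G (M L : R) : 0 <= M -> 0 <= L ->
  resolvent_family B G M L ->
  resolvent_family (B \o B)
    (fun u x => 2^-1 *: (G (sqrtC u) x + G (- sqrtC u) x)) M (L * (3 / 4)).
Proof.
move=> M0 L0 HG u u1.
have nmhalf (x : X) : nm (2^-1 *: x) = nm x / 2.
  by rewrite nmZ nmV (_ : 2 = 2%:C%C) ?nmR ?gtr0_norm 1?mulrC// raddfMn.
set v := sqrtC u; have v1 : nm v = 1 by exact: nm_sqrtC.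
have vN1 : nm (- v) = 1 by rewrite nmN.
have [iv bv lv] := HG v v1; have [iv' bv' lv'] := HG (- v) vN1.
split.
- by rewrite -{1}(sqrtCK u) -/v; exact: inverts_sqr_mean.
- move=> x; rewrite nmhalf; have := nmD (G v x) (G (- v) x).
  by have := bv x; have := bv' x; lra.
move=> u' u1' x; set w := sqrtC u'; have w1 : nm w = 1 by exact: nm_sqrtC.
have wN1 : nm (- w) = 1 by rewrite nmN.
have uE : nm (u - u') = nm (v - w) * nm (v + w).
  by rewrite -nmM -subr_sqr !sqrtCK.
have par := nm_parallelogram v w; rewrite v1 w1 in par.
rewrite -scalerBr nmhalf.
have x0 := nm_ge0 x; have p0 := nm_ge0 (v + w); have m0 := nm_ge0 (v - w).
suff [d [d1 d2]] : exists d : R,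
    nm (G v x + G (- v) x - (G w x + G (- w) x)) <= 2 * (L * d * nm x) /\
    d <= 3 / 4 * nm (u - u').
  have h := ler_wpM2r x0 (ler_wpM2l L0 d2).
  by lra.
(* [v] is paired with the nearer of [w] and [- w]; the jump of [sqrtC] is harmless because the mean
   is symmetric in the two roots. *)
have [h|h] := leP (nm (v - w)) (nm (v + w)).
  exists (nm (v - w)); split.
    rewrite opprD addrACA; apply: (le_trans (nmD _ _)).
    have := lv w w1 x; have := lv' (- w) wN1 x.
    by rewrite -opprD nmN; lra.
  (* By the parallelogram law the two squared distances add up to 4, so the larger distance is at
     least the square root of 2, hence at least 4/3. *)
  rewrite uE; have : 4 / 3 <= nm (v + w) by nra.
  by nra.
exists (nm (v + w)); split.
  rewrite [G w x + _]addrC opprD addrACA; apply: (le_trans (nmD _ _)).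
  have := lv (- w) wN1 x; have := lv' w w1 x.
  by rewrite opprK -opprD nmN; lra.
rewrite uE; have : 4 / 3 <= nm (v - w) by nra.
by nra.
Qed.

(* [A^(2^k)] *)
Fixpoint sqr_iter A k : {linear X -> X} :=
  if k is j.+1 then (sqr_iter A j \o sqr_iter A j : {linear X -> X}) else A.

(** The mean formula makes [Q k.+1 - Q k] half the difference of the inverses at -1 and 1, which the
    Lipschitz constant bounds geometrically. The product formula makes [Q k.+1] the product of these
    two inverses; as both tend to [P], the limit is idempotent. *)
Lemma spectral_projection A : bounded_operator A ->
  (forall u, nm u = 1 -> bijective (op_sub A u)) ->
  exists (P : X -> X) (Q : nat -> X -> X) (D : R),
    [/\ 0 <= D, forall k, inverts_1sub (sqr_iter A k) 1 (Q k),
     forall k x, nm (Q k x - P x) <= D * (3 / 4) ^+ k * nm x,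
     forall x, nm (P x) <= D * nm x & forall x, P (P x) = P x].
Proof.
move=> bA bij; have [G0 [M [L [M0 L0 HG0]]]] := resolvent_family0 bA bij.
pose G := fix G k := if k is j.+1 then
  fun u x => 2^-1 *: (G j (sqrtC u) x + G j (- sqrtC u) x) else G0.
have q0 : 0 <= (3 / 4 : R) by lra.
have HG k : resolvent_family (sqr_iter A k) (G k) M (L * (3 / 4) ^+ k).
  elim: k => [|k IH]; first by rewrite expr0 mulr1.
  rewrite exprSr (mulrA L); apply: (resolvent_family_sqr M0 _ IH).
  by rewrite mulr_ge0 ?exprn_ge0.
have one1 : nm (1 : R[i]) = 1 by exact: nm1.
have oneN1 : nm (- 1 : R[i]) = 1 by rewrite nmN nm1.
have iQ k : inverts_1sub (sqr_iter A k) 1 (G k 1) by have [] := HG k 1 one1.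
have iN k : inverts_1sub (sqr_iter A k) (- 1) (G k (- 1)) by have [] := HG k _ oneN1.
have bQ k x : nm (G k 1 x) <= M * nm x by have [_ h _] := HG k 1 one1.
have dQ k x : nm (G k 1 x - G k (- 1) x) <= L * (3 / 4) ^+ k * 2 * nm x.
  have [_ _ /(_ _ oneN1 x)] := HG k 1 one1.
  by rewrite opprK (_ : 1 + 1 = 2%:C%C) ?nmR ?gtr0_norm// raddfMn.
have QS k x : G k.+1 1 x = G k 1 (G k (- 1) x).
  have := inverts_sqr_comp (iQ k) (iN k); rewrite expr1n => h.
  exact: (inverts_unique (iQ k.+1) h).
have QD k x : nm (G k.+1 1 x - G k 1 x) <= L * nm x * (3 / 4) ^+ k.
  have -> : G k.+1 1 x - G k 1 x = 2^-1 *: (G k (- 1) x - G k 1 x).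
    rewrite /= sqrtC1 -{2}(scale_halfD (G k 1 x)) -scalerBr.
    by rewrite opprD addrACA subrr add0r.
  rewrite nmZ nmV (_ : 2 = 2%:C%C) ?nmR ?gtr0_norm// ?raddfMn//.
  by rewrite nm_distC; have := dQ k x; lra.
have q01 : 0 <= (3 / 4 : R) < 1 by apply/andP; split; lra.
have lim x : exists l, forall k, nm (G k 1 x - l) <= 4 * L * (3 / 4) ^+ k * nm x.
  have [l Hl] := complete_geometric q01 (fun k => QD k x).
  exists l => k; apply: (le_trans (Hl k)).
  have -> : (1 - 3 / 4)^-1 = 4 :> R by field.
  by lra.
have [P HP] := choice lim.
(* [4 * L] is the sum of the geometric series of ratio 3/4; [M] is added to bound [P] itself. *)
have D0 : 0 <= M + 4 * L by rewrite addr_ge0// mulr_ge0.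
exists P, (fun k => G k 1), (M + 4 * L); split => //.
- move=> k x /=; apply: (le_trans (HP x k)); apply: ler_wpM2r; first exact: nm_ge0.
  by apply: ler_wpM2r; [exact: exprn_ge0 | lra].
- move=> x; have := nmB (G 0%N 1 x) (G 0%N 1 x - P x); rewrite subKr.
  by have := HP x 0%N; have := bQ 0%N x; rewrite expr0; lra.
move=> x; apply/eqP; rewrite -subr_eq0; apply/eqP/nm_le0.
pose C := (4 * L + M * (2 * L + 4 * L)) * nm x + 4 * L * nm (P x).
apply: (le_geometric0 (c := C) q01) => k.
have gl := inverts_linear (iQ k).
have gB y z : G k 1 y - G k 1 z = G k 1 (y - z).
  by rewrite addrC -scaleN1r -gl scaleN1r addrC.
have h1 := HP x k.+1; have h2 := HP (P x) k.
have h3 : nm (G k 1 (G k (- 1) x) - G k 1 (P x)) <=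
    M * ((2 * L + 4 * L) * (3 / 4) ^+ k * nm x).
  rewrite gB; apply: (le_trans (bQ _ _)); apply: ler_wpM2l => //.
  rewrite -(subrKA (G k 1 x)); apply: (le_trans (nmD _ _)).
  by rewrite nm_distC; have := dQ k x; have := HP x k; lra.
have h4 : 4 * L * (3 / 4) ^+ k.+1 * nm x <= 4 * L * (3 / 4) ^+ k * nm x.
  apply: ler_wpM2r; first exact: nm_ge0.
  by apply: ler_wpM2l; [rewrite mulr_ge0 | rewrite exprS ler_piMl ?exprn_ge0//; lra].
rewrite QS in h1.
have -> : P (P x) - P x =
    (G k 1 (G k (- 1) x) - P x) - (G k 1 (G k (- 1) x) - G k 1 (P x)) -
    (G k 1 (P x) - P (P x)).
  rewrite !opprB (addrC (G k 1 (G k (- 1) x) - P x)) subrKA.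
  by rewrite [RHS]addrC subrKA.
apply: (le_trans (nmB _ _)); have := nmB (G k 1 (G k (- 1) x) - P x)
  (G k 1 (G k (- 1) x) - G k 1 (P x)).
by rewrite /C; lra.
Qed.

End SpectralProjection.

(** * Splitting off the quasi-nilpotent part *)

Section RieszDecomposition.
Context {R : realType} {X : completeNormedModType R[i]}.
Implicit Types (A T : {linear X -> X}) (V : {pred X}).

Lemma sqr_iter_comm A (f : X -> X) : (forall x, f (A x) = A (f x)) ->
  forall k x, f (sqr_iter A k x) = sqr_iter A k (f x).
Proof. by move=> fA; elim=> //= k IH x; rewrite !IH. Qed.

Lemma sqr_iter_stable A V : (forall x, x \in V -> A x \in V) ->
  forall k x, x \in V -> sqr_iter A k x \in V.
Proof. by move=> VA; elim=> //= k IH x Vx; exact: (IH _ (IH _ Vx)). Qed.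

(** Repeated use of [a^2 - b^2 = (a - b) (a + b)], carried out inside [V]. It turns preimages under
    [A^(2^k) - mu^(2^k)] into preimages under [A - mu]. *)
Lemma sqr_iter_sub_factor A V mu : GRing.submod_closed V ->
  (forall x, x \in V -> A x \in V) -> forall k x, x \in V ->
  exists2 y, y \in V & op_sub A mu y = sqr_iter A k x - mu ^+ (2 ^ k) *: x.
Proof.
move=> [V0 VD] VA; elim=> [|k IH] x Vx; first by exists x; rewrite // expr1.
have [|y Vy E] := IH (mu ^+ (2 ^ k) *: x + sqr_iter A k x).
  by apply: VD => //; exact: sqr_iter_stable.
exists y => //; rewrite E (opD (sqr_iter A k)) (opZ (sqr_iter A k)) scalerDr scalerA.
rewrite (addrC (_ *: sqr_iter A k x)) (addrC (_ *: x)) addrKA.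
by rewrite -exprD addnn -mul2n -expnS.
Qed.

Lemma sqr_iter_eigen A mu x : A x = mu *: x ->
  forall k, sqr_iter A k x = mu ^+ (2 ^ k) *: x.
Proof.
move=> Ax; elim=> [|k IH] /=; first by rewrite expr1.
by rewrite IH (opZ (sqr_iter A k)) IH scalerA -exprD addnn -mul2n -expnS.
Qed.

Lemma linear_geometric_lim (f : X -> X) (g : nat -> X -> X) (D q : R) :
  0 <= q < 1 -> (forall k, linear (g k)) ->
  (forall k x, nm (g k x - f x) <= D * q ^+ k * nm x) -> linear f.
Proof.
move=> q01 gl gf a x y; apply/eqP; rewrite -subr_eq0; apply/eqP/nm_le0.
pose C := D * (nm (a *: x + y) + nm a * nm x + nm y).
apply: (le_geometric0 (c := C) q01) => k.
have -> : f (a *: x + y) - (a *: f x + f y) =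
    - (g k (a *: x + y) - f (a *: x + y)) +
    (a *: (g k x - f x) + (g k y - f y)).
  rewrite gl opprB -addrA; congr (_ + _).
  by rewrite scalerBr addrACA addKr opprD.
apply: (le_trans (nmD _ _)).
have := nmD (a *: (g k x - f x)) (g k y - f y); rewrite nmN nmZ.
have := gf k (a *: x + y); have := gf k y.
have := ler_wpM2l (nm_ge0 a) (gf k x); rewrite /C; lra.
Qed.

(** [X1] is the kernel and [X2] the range of the projection [P]. One [k] with error [E = Q k - P] of
    norm at most 1/4 suffices: [1 + b E] is then bijective whenever [nm b <= 2], and each claim not
    contained in the hypothesis reduces to this for a suitable [b]. *)
Theorem riesz_decomposition_disk A : bounded_operator A ->
  (forall mu, 0 < nm mu <= 1 -> bijective (op_sub A mu)) ->
  exists X1 X2 : closedSubspace X, [/\ direct_sum X1 X2,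
    invariant_subspace A X1, invariant_subspace A X2,
    bijective_on (csub_pred X1) A &
    forall mu, mu != 0 -> bijective_on (csub_pred X2) (op_sub A mu)].
Proof.
move=> bA bij.
have [|P [Q [D [D0 iQ PQ bP PP]]]] := spectral_projection bA.
  by move=> u u1; apply: bij; rewrite u1 ltr01 lexx.
have q01 : 0 <= (3 / 4 : R) < 1 by apply/andP; split; lra.
have Ql k : linear (Q k) := inverts_linear (iQ k).
have Pl : linear P := linear_geometric_lim q01 Ql PQ.
have QA k x : Q k (A x) = A (Q k x).
  apply: (inverts_comm (iQ k)) => [a y z|y]; first by rewrite linearP.
  by apply: (sqr_iter_comm (A := A)).
have PA x : P (A x) = A (P x).
  apply/eqP; rewrite -subr_eq0; apply/eqP/nm_le0.
  have [a a0 Aa] := (bounded_nearP A).1 bA.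
  apply: (le_geometric0 (c := D * nm (A x) + a * (D * nm x)) q01) => k.
  have -> : P (A x) - A (P x) = A (Q k x - P x) - (Q k (A x) - P (A x)).
    by rewrite (opB A) QA opprB [RHS]addrC subrKA.
  apply: (le_trans (nmB _ _)); have := Aa (Q k x - P x).
  by have := PQ k (A x); have := ler_wpM2l (ltW a0) (PQ k x); lra.
have PQc k x : Q k (P x) = P (Q k x).
  by apply: (inverts_comm (iQ k)) => // y; apply: sqr_iter_comm.
pose P' : {linear X -> X} := HB.pack P (GRing.isLinear.Build _ _ _ _ P Pl).
have PD x y : P (x + y) = P x + P y by exact: (opD P').
have PB x y : P (x - y) = P x - P y by exact: (opB P').
have PN x : P (- x) = - P x by exact: (opN P').
have PZ a x : P (a *: x) = a *: P x by exact: (opZ P').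
have P0 : P 0 = 0 by exact: (op0 P').
have [k Dk] : exists k, D * (3 / 4) ^+ k <= 1 / 4.
  have e0 : 0 < 1 / 4 :> R by lra.
  by have [k /(_ k (leqnn _)) h] := small_geometric D q01 e0; exists k; exact: ltW.
pose Q' : {linear X -> X} :=
  HB.pack (Q k) (GRing.isLinear.Build _ _ _ _ (Q k) (Ql k)).
have QZ a x : Q k (a *: x) = a *: Q k x by exact: (opZ Q').
have Q0 : Q k 0 = 0 by exact: (op0 Q').
pose E x := Q k x - P x.
have El : linear E.
  by move=> a x y; rewrite /E Ql Pl opprD addrACA scalerBr.
have EP x : P (E x) = E (P x) by rewrite /E PB PQc.
have solve b : nm b <= 2 -> (forall x, x + b *: E x = 0 -> x = 0) /\
    (forall y, exists x, x + b *: E x = y).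
  move=> b2; pose f x := x + b *: E x.
  have fl : linear f.
    move=> a x y; rewrite /f El !scalerDr addrACA !scalerA.
    by rewrite (mulrC b).
  pose F : {linear X -> X} := HB.pack f (GRing.isLinear.Build _ _ _ _ f fl).
  have bF : bijective F.
    apply: (@perturbation_bijective _ _ idfun F 1) => //.
    - by move=> x; rewrite mul1r.
    move=> x; rewrite /F /= /f addrAC subrr add0r nmZ.
    have h : nm (E x) <= 1 / 4 * nm x.
      by apply: (le_trans (PQ k x)); apply: ler_wpM2r; rewrite ?nm_ge0.
    have := ler_pM (nm_ge0 b) (nm_ge0 (E x)) b2 h; lra.
  by split=> [x|y]; [exact: (bijective_ker0 bF) | exact: (bijective_surj bF)].
have BQ x : sqr_iter A k (Q k x) = Q k x - x.
  by have [_ /(_ x)] := iQ k; rewrite scale1r => h; rewrite -{3}h subKr.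
have clP : forall x e, 0 < e -> exists2 d : R, 0 < d &
    forall y, nm (x - y) < d -> nm (P x - P y) < e.
  move=> x e e0; have D1 : 0 < D + 1 by rewrite ltr_wpDl.
  exists (e / (D + 1)); first by rewrite divr_gt0.
  move=> y; rewrite ltr_pdivlMr// -PB => h; apply: le_lt_trans (bP _) _.
  by have := nm_ge0 (x - y); lra.
have cl1 : closed [set x | P x = 0].
  apply/closed_nmP => x Hx /=; apply/nm_le0/ler_addgt0Pr => e e0.
  have [d d0 Hd] := clP x e e0; have [y /= Py /Hd] := Hx d d0.
  by rewrite Py subr0 add0r => /ltW.
have cl2 : closed [set x | P x = x].
  apply/closed_nmP => x Hx /=; apply/eqP; rewrite -subr_eq0.
  apply/eqP/nm_le0/ler_addgt0Pr => e e0; have e2 : 0 < e / 2 by lra.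
  have [d d0 Hd] := clP x _ e2.
  have [|y /= Py] := Hx (Num.min d (e / 2)); first by rewrite lt_min d0.
  rewrite lt_min => /andP[/Hd]; rewrite Py => h1 h2.
  rewrite -(subrKA y); apply: (le_trans (nmD _ _)).
  by rewrite (nm_distC y); lra.
have X10 : [set x | P x = 0] 0 by [].
have X20 : [set x | P x = x] 0 by [].
have X1D a x y : [set x | P x = 0] x -> [set x | P x = 0] y ->
    [set x | P x = 0] (a *: x + y).
  by rewrite /= Pl => -> ->; rewrite scaler0 addr0.
have X2D a x y : [set x | P x = x] x -> [set x | P x = x] y ->
    [set x | P x = x] (a *: x + y) by rewrite /= Pl => -> ->.
pose X1 := closed_subspace X10 X1D cl1.
pose X2 := closed_subspace X20 X2D cl2.
have X1P x : x \in csub_pred X1 <-> P x = 0 by exact: mem_closed_subspace.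
have X2P x : x \in csub_pred X2 <-> P x = x by exact: mem_closed_subspace.
have X1A x : x \in csub_pred X1 -> A x \in csub_pred X1.
  by move=> /X1P Px; apply/X1P; rewrite PA Px op0.
have X2A x : x \in csub_pred X2 -> A x \in csub_pred X2.
  by move=> /X2P Px; apply/X2P; rewrite PA Px.
exists X1, X2; split => //.
- split=> [x|x /X1P Px /X2P]; last by rewrite Px => <-.
  exists (x - P x), (P x); split; last by rewrite subrK.
    by apply/X1P; rewrite PB PP subrr.
  by apply/X2P; rewrite PP.
(* On [X1] one has [Q k = E], so [A^(2^k)] applied to [- Q k] is [1 - E]; hence [b = -1]. *)
- have nmN1 : nm (-1 : R[i]) <= 2 by rewrite nmN nm1; lra.
  have [inj surj] := solve (-1) nmN1.
  split=> [x /X1P Px Ax|x /X1P Px].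
    have Bx : sqr_iter A k x = 0.
      by elim: (k) => //= j ->; rewrite op0.
    have [/(_ x) + _] := iQ k; rewrite Bx scaler0 subr0 => Qx.
    by apply: inj; rewrite /E Qx Px subr0 scaleN1r subrr.
  have [w Hw] := surj x.
  have Pw : P w = 0.
    by apply: inj; rewrite -EP -PZ -PD Hw.
  have X1Qw : - Q k w \in csub_pred X1.
    by apply/X1P; rewrite PN -PQc Pw Q0 oppr0.
  have [y X1y] := @sqr_iter_sub_factor _ _ 0 (csub_submod X1) X1A k _ X1Qw.
  rewrite op_subE expr0n expn_eq0 /= !scale0r !subr0 (opN (sqr_iter A k)) BQ opprB => Ay.
  exists y => //; rewrite Ay -Hw.
  by rewrite /E Pw subr0 scaleN1r.
move=> mu mu0; have [mu1|mu1] := leP (nm mu) 1.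
  have bmu : bijective (op_sub A mu) by apply: bij; rewrite nm_gt0 mu0.
  split=> [x _|y /X2P Py]; first exact: bijective_ker0.
  have [x Hx] := bijective_surj bmu y; exists x => //; apply/X2P.
  apply: (bij_inj bmu); rewrite Hx -Py -Hx !op_subE PB PZ PA //.
pose nu := mu ^+ (2 ^ k); have nu0 : nu != 0 by rewrite expf_neq0.
(* On [X2] one has [Q k = 1 + E], and [A^(2^k) - nu] applied to [Q k] is [- nu] times [1 + b E];
   [nm b <= 2] because [nm nu >= 1]. *)
pose b := 1 - nu^-1.
have b2 : nm b <= 2.
  have : nm nu^-1 <= 1.
    rewrite nmV nmX invf_le1; first by apply: exprn_ege1; exact: ltW.
    by rewrite exprn_gt0//; lra.
  by have := nmB 1 nu^-1; rewrite -/b nm1; lra.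
have [inj surj] := solve b b2.
split=> [x /X2P Px /eqP|y X2y].
  rewrite op_subE subr_eq0 => /eqP Ax; apply: inj.
  have [/(_ x) + _] := iQ k.
  rewrite (sqr_iter_eigen Ax) scale1r -/nu -{1}[x]scale1r -scalerBl => Qx.
  rewrite QZ in Qx.
  have bE : b = - nu^-1 * (1 - nu) by rewrite mulrBr mulr1 mulNr mulVf// opprK addrC.
  have bQ : b *: Q k x = - (nu^-1 *: x) by rewrite bE -scalerA Qx scaleNr.
  by rewrite /E Px scalerBr bQ /b scalerBl scale1r opprB addKr subrr.
have [w Hw] := surj (- nu^-1 *: y); have Py := (X2P y).1 X2y.
have EB z t : E (z - t) = E z - E t.
  by rewrite addrC -scaleN1r El scaleN1r addrC.
have Pw : P w = w.
  apply/eqP; rewrite -subr_eq0 -oppr_eq0 opprB; apply/eqP/inj.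
  rewrite EB scalerBr addrACA -opprD Hw.
  by rewrite -EP -PZ -PD Hw PZ Py subrr.
have X2Qw : Q k w \in csub_pred X2 by apply/X2P; rewrite -PQc Pw.
have [x X2x Hx] := @sqr_iter_sub_factor _ _ mu (csub_submod X2) X2A k _ X2Qw.
exists x => //; rewrite Hx BQ -/nu.
have QE : Q k w = E w + w by rewrite /E Pw subrK.
have -> : y = - nu *: (w + b *: E w).
  by rewrite Hw scalerA mulrNN mulfV// scale1r.
have nub : - nu * b = 1 - nu by rewrite mulrBr mulr1 mulNr mulfV// opprK addrC.
rewrite QE addrK; move: (E w) => e.
rewrite !scalerDr scalerA nub scalerBl scale1r scaleNr opprD.
by rewrite [RHS]addrC -addrA.
Qed.

End RieszDecomposition.

(** * Finite spectrum and emptiness of the other spectra *)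

Section FiniteSpectrum.
Context {R : realType} {X : completeNormedModType R[i]}.
Implicit Types (S T : {linear X -> X}).

Lemma bijective_weyl S : bijective S -> weyl S.
Proof.
move=> bS.
have dim0 : has_dim (op_kernel S) 0.
  exists (fun=> 0); split=> [[]//|x Nx]; exists 0; split.
    by rewrite big_ord0; exact: (bijective_ker0 bS).
  by move=> c _; rewrite [RHS]thinmx0.
have codim0 : has_codim (range S) 0.
  exists (fun=> 0) => x; exists 0; split.
    by rewrite big_ord0 subr0; have [y <-] := bijective_surj bS x; exists y.
  by move=> c _; rewrite [RHS]thinmx0.
by split; [split; exists 0%N | exists 0%N, 0%N].
Qed.

Lemma bijective_kato S : bijective S -> kato S.
Proof.
move=> bS; split; last first.
  move=> x Nx n _; rewrite (bijective_ker0 bS Nx); exists 0 => //.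
  by elim: n => //= n ->; rewrite op0.
rewrite (_ : range S = setT); first exact: closedT.
by rewrite -subTset => y _; have [x <-] := bijective_surj bS y; exists x.
Qed.

(** Dividing [T] by [r] brings the punctured disk to radius 1. Only bijectivity of the first summand
    is used, so one statement serves the Fredholm, Weyl and Kato classes. *)
Lemma isolated_pseudo (P : forall Y : completeNormedModType R[i],
    {linear Y -> Y} -> Prop) T (r : R) :
  (forall (Y : completeNormedModType R[i]) (S : {linear Y -> Y}),
    bijective S -> P Y S) ->
  bounded_operator T -> 0 < r ->
  (forall z, 0 < nm z <= r -> bijective (op_sub T z)) -> pseudo P T.
Proof.
move=> HP bT r0 Hr; have [b b0 Tb] := (bounded_nearP T).1 bT.
pose s := r%:C%C; have s0 : s != 0 by rewrite -nm_gt0 nmR gtr0_norm.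
have ns : nm s = r by rewrite nmR gtr0_norm.
pose A : {linear X -> X} := s^-1 \*: T.
have AE x : A x = s^-1 *: T x by [].
have bA : bounded_operator A.
  apply/bounded_nearP; exists (r^-1 * b); first by rewrite mulr_gt0// invr_gt0.
  move=> x; rewrite AE nmZ nmV ns -mulrA; apply: ler_wpM2l => //.
  by rewrite invr_ge0 ltW.
have subE mu x : op_sub A mu x = s^-1 *: op_sub T (s * mu) x.
  by rewrite !op_subE AE scalerBr scalerA mulKf.
have [|X1 [X2 [dsum inv1 inv2 b1 b2]]] := riesz_decomposition_disk bA.
  move=> mu /andP[mu0 mu1].
  have bij : bijective (op_sub T (s * mu)).
    by apply: Hr; rewrite nmM ns mulr_gt0//= ler_piMr// ltW.
  have bs : bijective (fun x : X => s^-1 *: x).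
    by exists ( *:%R s) => x; rewrite scalerA (mulfV, mulVf)// scale1r.
  by apply: (eq_bij (bij_comp bs bij)) => x; rewrite subE.
have invT (M : closedSubspace X) : invariant_subspace A M -> invariant_subspace T M.
  move=> AM x Mx; have [M0 MZ] := csub_submod M.
  have -> : T x = s *: A x + 0 by rewrite AE scalerA mulfV// scale1r addr0.
  by apply: MZ => //; exact: AM.
exists X1, X2, (invT _ inv1), (invT _ inv2); split => //.
  apply/HP/op_sub0_bijective/restrict_bijectiveP; case: b1 => inj surj.
  split=> [x Mx|y My]; rewrite ?op_subE ?scale0r ?subr0.
    by move=> Tx; apply: inj => //; rewrite AE Tx scaler0.
  have [M0 MZ] := csub_submod X1.
  have [|x Mx Ax] := surj (s^-1 *: y + 0); first exact: MZ.
  exists x => //; rewrite op_subE scale0r subr0 -[y](scalerKV s0).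
  by rewrite -(addr0 (s^-1 *: y)) -Ax AE scalerA mulfV ?scale1r.
move=> z nz; apply: contrapT => /eqP z0; apply: nz.
apply: bijective_invertible.
  by apply/op_sub_bounded/op_restrict_bounded.
apply/restrict_bijectiveP.
have [|inj surj] := b2 (s^-1 * z); first by rewrite mulf_neq0 ?invr_eq0.
have zE : s * (s^-1 * z) = z by rewrite mulVKf.
split=> [x Mx Tx|y My].
  by apply: inj => //; rewrite subE zE Tx scaler0.
have [M0 MZ] := csub_submod X2.
have [|x Mx Ax] := surj (s^-1 *: y + 0); first exact: MZ.
exists x => //; rewrite -[y](scalerKV s0) -(addr0 (s^-1 *: y)) -Ax subE zE.
by rewrite scalerA mulfV ?scale1r.
Qed.

Lemma finite_spectrum_pseudo (P : forall Y : completeNormedModType R[i],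
    {linear Y -> Y} -> Prop) T :
  (forall (Y : completeNormedModType R[i]) (S : {linear Y -> Y}),
    bijective S -> P Y S) ->
  bounded_operator T -> finite_set (spectrum T) ->
  [set l | ~ pseudo P (op_sub T l)] = set0.
Proof.
move=> HP bT /finite_isolated fT; rewrite -subset0 => l; apply.
have [r r0 Hr] := fT l.
apply: (isolated_pseudo HP (op_sub_bounded l bT) r0) => z zr.
have h : ~ spectrum T (z + l) by apply: Hr; rewrite addrK.
have : bijective (op_sub T (z + l)).
  by apply: contrapT => nb; apply: h; apply/spectrumP.
by move/(op_sub_op_sub_bijective T l (z + l)); rewrite addrK.
Qed.

Lemma pseudo_spectrum_finite (P : forall Y : completeNormedModType R[i],
    {linear Y -> Y} -> Prop) T :
  (forall (Y : completeNormedModType R[i]) (S : {linear Y -> Y}),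
    bounded_operator S -> P Y S -> punctured_dichotomy S) ->
  bounded_operator T -> [set l | ~ pseudo P (op_sub T l)] = set0 ->
  finite_set (spectrum T).
Proof.
move=> HP bT pT; apply: dichotomy_spectrum_finite => // l.
apply: (pseudo_dichotomy HP); first exact: op_sub_bounded.
by apply: contrapT => np; have : set0 l by rewrite -pT.
Qed.

End FiniteSpectrum.

Theorem proposition2p2 (R : realType) (X : completeNormedModType R[i])
    (T : {linear X -> X}) (hT : bounded_operator T) :
  [<-> sigma_pBF T = set0;
       sigma_pBW T = set0;
       sigma_GK T = set0;
       finite_set (spectrum T)].
Proof.
have bF (Y : completeNormedModType R[i]) (S : {linear Y -> Y}) :
    bijective S -> fredholm S by move=> /bijective_weyl[].
have bW (Y : completeNormedModType R[i]) (S : {linear Y -> Y}) :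
    bijective S -> weyl S by exact: bijective_weyl.
have bK (Y : completeNormedModType R[i]) (S : {linear Y -> Y}) :
    bijective S -> kato S by exact: bijective_kato.
have dW (Y : completeNormedModType R[i]) (S : {linear Y -> Y}) :
    bounded_operator S -> weyl S -> punctured_dichotomy S.
  by move=> bS [fS _]; exact: fredholm_dichotomy.
(* The first two implications also pass through finiteness of the spectrum. *)
tfae.
- move=> /(pseudo_spectrum_finite (@fredholm_dichotomy R) hT).
  exact: finite_spectrum_pseudo.
- by move=> /(pseudo_spectrum_finite dW hT); exact: finite_spectrum_pseudo.
- exact: (pseudo_spectrum_finite (@kato_dichotomy R) hT).
- exact: finite_spectrum_pseudo.
Qed.
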